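(* Let $d=2^n$. Suppose an unknown $n$-qubit channel $\mathcal{C}$ is, with equal probability, either the completely depolarizing channel $\mathcal{D}(\rho)=\mathrm{Tr}(\rho)\,I/d$, or the unitary channel $\mathcal{U}(\rho)=U\rho U^\dagger$ for a single fixed unitary $U$ drawn from the Haar measure on $U(d)$. Any learning algorithm without quantum memory (for channels) that decides which case holds with success probability at least $2/3$ must use $T\ge\Omega(d^{1/3})$ applications of $\mathcal{C}$.
   Context: A learning algorithm without quantum memory for an unknown $n$-qubit channel $\mathcal{C}$, using $T$ applications, proceeds in $T$ rounds, with an auxiliary register of an arbitrary number $n'\ge0$ of qubits: in each round it chooses (depending arbitrarily on all previously observed classical outcomes) a pure state $|\phi\rangle$ on $n+n'$ qubits and a POVM $\{F_s\}_s$ on $n+n'$ qubits, applies $\mathcal{C}$ to the first $n$ qubits (i.e. forms $(\mathcal{C}\otimes\mathrm{id})(|\phi\rangle\langle\phi|)$), and observes outcome $s$ with probability $\mathrm{Tr}\big(F_s(\mathcal{C}\otimes\mathrm{id})(|\phi\rangle\langle\phi|)\big)$; no quantum state is retained between rounds. Its final output is an arbitrary function of the classical outcomes. *)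

(* Defs.v *)
From HB Require Import structures.
From mathcomp Require Import all_boot all_order all_algebra.
From mathcomp Require Import complex mxtens.
From mathcomp Require Import all_classical all_reals all_analysis.

Set Implicit Arguments.
Unset Strict Implicit.
Unset Printing Implicit Defensive.

Import Order.TTheory GRing.Theory Num.Theory.
Import numFieldTopology.Exports numFieldNormedType.Exports.

Local Open Scope ring_scope.
Local Open Scope classical_set_scope.
Local Open Scope sesquilinear_scope.

Section QuantumLearning.
Variable R : realType.
Local Notation C := (R[i]).

(* Borel measurable space on d x d complex matrices.                  *)
(* The carrier 'M[C^o]_d is (convertible to) 'M[C]_d, equipped with   *)
(* the entrywise (product) topology of C; MB d is its Borel sigma-    *)
(* algebra (generated by the open sets).                              *)
Definition MB (d : nat) := g_sigma_algebraType (@open 'M[C^o]_(d, d)).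
Definition toC (d : nat) (M : MB d) : 'M[C]_d := M.
Definition ofC (d : nat) (M : 'M[C]_d) : MB d := M.

Definition unitary_set (d : nat) : set (MB d) := [set M | toC M \is unitarymx].

(* mu is the Haar (probability) measure on U(d): a probability measure *)
(* on the Borel sets, supported on U(d), and invariant under left     *)
(* multiplication by every unitary V (this characterises the Haar    *)
(* measure uniquely).                                                 *)
Definition haar_prob (d : nat) (mu : probability (MB d) R) : Prop :=
  mu (@unitary_set d) = 1%E /\
  forall V : 'M[C]_d, V \is unitarymx ->
    forall A : set (MB d), measurable A ->
      mu ((fun M : MB d => ofC (V *m toC M)) @^-1` A) = mu A.

Definition depolarizing (d : nat) (X : 'M[C]_d) : 'M[C]_d :=
  (\tr X / d%:R)%:M.

Definition unitary_channel (d : nat) (U : 'M[C]_d) (X : 'M[C]_d) : 'M[C]_d :=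
  U *m X *m U ^t*.

(* (Phi (x) id) on the system (x) auxiliary space, C^d (x) C^e, with  *)
(* the tensor product realised by mxtens (Kronecker product):          *)
(* rho = \sum_{a,b} rho_{ab} (x) E_{ab}  |->  \sum_{a,b} Phi(rho_{ab}) (x) E_{ab}. *)
Definition tens_id (d e : nat) (Phi : 'M[C]_d -> 'M[C]_d)
    (rho : 'M[C]_(d * e)) : 'M[C]_(d * e) :=
  \sum_(a < e) \sum_(b < e)
     (Phi (\matrix_(i, j) rho (mxtens_index (i, a)) (mxtens_index (j, b)))
        *t (delta_mx a b : 'M[C]_e)).

Definition unit_vector (D : nat) (psi : 'cV[C]_D) : Prop :=
  psi ^t* *m psi = 1%:M.

Definition density (D : nat) (psi : 'cV[C]_D) : 'M[C]_D := psi *m psi ^t*.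

Definition psd (D : nat) (F : 'M[C]_D) : Prop :=
  forall v : 'cV[C]_D, 0 <= (v ^t* *m F *m v) 0 0.

Definition is_povm (D K : nat) (F : 'I_K -> 'M[C]_D) : Prop :=
  (forall s, psd (F s)) /\ \sum_(s < K) F s = 1%:M.

(* Learning algorithms without quantum memory.                          *)
(* n system qubits, n' auxiliary qubits, outcomes in 'I_K.              *)
(* In each round, the input pure state and the POVM are arbitrary       *)
(* functions of the history (sequence of previous outcomes); the final *)
(* answer is an arbitrary function of the whole transcript              *)
(* (true = "the channel is the unitary channel").                      *)
Record algo (n n' K : nat) := Algo {
  alg_state : seq 'I_K -> 'cV[C]_(2 ^ n * 2 ^ n');
  alg_povm  : seq 'I_K -> 'I_K -> 'M[C]_(2 ^ n * 2 ^ n');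
  alg_out   : seq 'I_K -> bool }.

Definition algo_valid (n n' K : nat) (A : algo n n' K) : Prop :=
  forall h : seq 'I_K,
    unit_vector (alg_state A h) /\ is_povm (alg_povm A h).

Definition transcript_prob (n n' K T : nat) (A : algo n n' K)
    (Phi : 'M[C]_(2 ^ n) -> 'M[C]_(2 ^ n)) (tr : T.-tuple 'I_K) : C :=
  \prod_(t < T)
    \tr (alg_povm A (take t tr) (tnth tr t)
         *m tens_id Phi (density (alg_state A (take t tr)))).

Definition output_prob (n n' K T : nat) (A : algo n n' K)
    (Phi : 'M[C]_(2 ^ n) -> 'M[C]_(2 ^ n)) (b : bool) : C :=
  \sum_(tr : T.-tuple 'I_K | alg_out A tr == b) transcript_prob A Phi tr.

Definition success_prob (n n' K T : nat) (A : algo n n' K)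
    (mu : probability (MB (2 ^ n)) R) : \bar R :=
  ((2^-1 : R) * complex.Re (output_prob T A (@depolarizing (2 ^ n)) false))%:E
  + ((2^-1 : R)%:E *
     \int[mu]_(M in @unitary_set (2 ^ n))
        (complex.Re (output_prob T A (unitary_channel (toC M)) true))%:E)%E.

End QuantumLearning.

(* Main.v *)
Require Import Defs.
From HB Require Import structures.
From mathcomp Require Import all_boot all_order all_algebra.
From mathcomp Require Import complex mxtens.
From mathcomp Require Import all_classical all_reals all_analysis.
From mathcomp Require Import measurable_realfun ring lra.
Import Order.TTheory GRing.Theory Num.Theory.
Import numFieldTopology.Exports numFieldNormedType.Exports.
Local Open Scope ring_scope.

(** A POVM element [S^* S] applied to [(U (x) 1)|phi>] has probability
    [sum_k |tr (U A_k)|^2], where [A_k] contracts [phi] with the [k]-th row of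
    [S], against [sum_k |A_k|^2 / d] for the depolarizing channel, where [|A|]
    is the Frobenius norm.  The theorem therefore reduces to the bound
      [E prod_(t < T) |tr (U A_t)|^2 >= prod_(t < T) |A_t|^2 / (d + t)],
    which makes every transcript at least [prod_t d / (d + t) >= 1 - T^2 / d]
    times as likely under a Haar unitary as under depolarization; this even
    gives [T >= Omega(d^(1/2))].

    For a homogeneous polynomial [g] of degree [T + 1] in the entries of [U],
    invariance of the Haar measure identifies [E |grad g|^2] with
    [E conj(g) Cg], where the Casimir operator [C] is [d (T + 1)] plus the sum
    of all swaps of the row indices of two letters.  [C] commutes with the
    positive moment kernel and is at most [(T + 1) (d + T)], so that
    [E |g|^2 >= E |grad g|^2 / ((T + 1) (d + T))].  Iterating, [E |g|^2]
    dominates the Fock norm of [g] divided by [T! prod_t (d + t)], now for [g]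
    of degree [T], and the Fock norm of a product of [T] linear forms is at
    least [T!] times the product of their norms since creation operators
    satisfy [a a^* = a^* a + 1]. *)

Set Implicit Arguments.
Unset Strict Implicit.
Unset Printing Implicit Defensive.

(** * Words and the Fock form *)

Section Words.
Variable X : finType.

Definition word T := {ffun 'I_T -> X}.

Definition insert T (s : 'I_T.+1) (x : X) (u : word T) : word T.+1 :=
  [ffun t => oapp u x (unlift s t)].

Definition delete T (s : 'I_T.+1) (w : word T.+1) : word T :=
  [ffun t => w (lift s t)].

Lemma insert_at T (s : 'I_T.+1) x u : insert s x u s = x.
Proof. by rewrite ffunE unlift_none. Qed.

Lemma insert_lift T (s : 'I_T.+1) x u t : insert s x u (lift s t) = u t.
Proof. by rewrite ffunE liftK. Qed.

Lemma insert_neq T (s : 'I_T.+1) x (w : word T.+1) t :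
  t != s -> insert s x (delete s w) t = w t.
Proof.
by case: (unliftP s t) => [t' ->|->]; rewrite ?eqxx // insert_lift ffunE.
Qed.

Lemma insertK T (s : 'I_T.+1) x : cancel (insert s x) (delete s).
Proof. by move=> u; apply/ffunP => t; rewrite ffunE insert_lift. Qed.

Lemma deleteK T (s : 'I_T.+1) (w : word T.+1) : insert s (w s) (delete s w) = w.
Proof.
apply/ffunP => t; have [->|ts] := eqVneq t s; first exact: insert_at.
exact: insert_neq.
Qed.

Lemma insert_lift0 T (s : 'I_T.+1) y z (u : word T) :
  insert (lift ord0 s) y (insert ord0 z u) = insert ord0 z (insert s y u).
Proof.
rewrite -[LHS](deleteK ord0); congr insert.
  rewrite ffunE; case: unliftP => [t /(congr1 val)/esym/eqP|/eqP]; last first.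
    by rewrite (negPf (neq_lift _ _)).
  rewrite addn_eq0 => /andP[_ /eqP t0].
  by rewrite (_ : t = ord0) /= ?insert_at //; apply: val_inj.
apply/ffunP => t; rewrite ffunE; case: (unliftP s t) => [t' ->|->].
  rewrite (_ : lift (ord0 : 'I_T.+2) (lift s t') =
      lift (lift ord0 s) (lift ord0 t')).
    by rewrite !insert_lift.
  by apply/val_inj; rewrite /= /bump !leq0n !add1n ltnS addnS.
by rewrite !insert_at.
Qed.

Lemma big_word (R : Type) (idx : R) (op : Monoid.com_law idx) T (s : 'I_T.+1)
    (F : word T.+1 -> R) :
  \big[op/idx]_w F w = \big[op/idx]_x \big[op/idx]_u F (insert s x u).
Proof.
rewrite pair_big (reindex (fun p => insert s p.1 p.2)) //=.
exists (fun w : word T.+1 => (w s, delete s w)) => [[x u] _|w _] /=.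
  by rewrite insert_at insertK.
exact: deleteK.
Qed.

Definition word0 : word 0 := ffun0 (card_ord 0).

Lemma word0_unique (w : word 0) : w = word0.
Proof. by apply/ffunP => -[]. Qed.

Lemma big_word0 (R : Type) (idx : R) (op : Monoid.law idx) (F : word 0 -> R) :
  \big[op/idx]_w F w = F word0.
Proof.
by rewrite (big_pred1 word0) // => w; rewrite (word0_unique w) /= eqxx.
Qed.

End Words.

Section Fock.
Variables (C : numClosedFieldType) (X : finType).
Local Notation word := (word X).

Definition annihilate T (x : X) (v : word T.+1 -> C) (u : word T) : C :=
  \sum_s v (insert s x u).

Definition create T (l : X -> C) (f : word T -> C) (w : word T.+1) : C :=
  l (w ord0) * f (delete ord0 w).

Fixpoint fock_form T : (word T -> C) -> (word T -> C) -> C :=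
  if T is T'.+1 then
    fun f g => \sum_x fock_form (annihilate x f) (annihilate x g)
  else fun f g => \sum_w (f w)^* * g w.

Lemma fock_formS T (f g : word T.+1 -> C) :
  fock_form f g = \sum_x fock_form (annihilate x f) (annihilate x g).
Proof. by []. Qed.

Lemma annihilate_insert0 T x (v : word T.+2 -> C) z u :
  annihilate x v (insert ord0 z u) =
  v (insert ord0 x (insert ord0 z u)) +
  annihilate x (fun w => v (insert ord0 z w)) u.
Proof.
rewrite /annihilate big_ord_recl; congr (_ + _).
by apply: eq_bigr => s _; rewrite insert_lift0.
Qed.

Lemma annihilateD T x (f g : word T.+1 -> C) u :
  annihilate x (fun w => f w + g w) u = annihilate x f u + annihilate x g u.
Proof. by rewrite /annihilate big_split. Qed.

Lemma annihilateC T x y (v : word T.+2 -> C) :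
  annihilate x (annihilate y v) = annihilate y (annihilate x v).
Proof.
apply/funext; elim: T v => [|T IH] v u.
  rewrite /annihilate !big_ord_recl !big_ord0 !addr0.
  by rewrite !(insert_lift0 (ord0 : 'I_1)) addrC.
rewrite -(deleteK ord0 u); move: (u ord0) (delete ord0 u) => z {}u.
have split0 t : (fun w => annihilate t v (insert ord0 z w)) =
    fun w => v (insert ord0 t (insert ord0 z w)) +
             annihilate t (fun w => v (insert ord0 z w)) w.
  by apply/funext => w; rewrite annihilate_insert0.
by rewrite !annihilate_insert0 !split0 !annihilateD IH; ring.
Qed.

Lemma annihilate_create0 x l (f : word 0 -> C) :
  annihilate x (create l f) = fun u => l x * f u.
Proof.
apply/funext => u.
by rewrite /annihilate big_ord_recl big_ord0 addr0 /create insert_at insertK.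
Qed.

Lemma annihilate_create T x l (f : word T.+1 -> C) :
  annihilate x (create l f) = fun u => l x * f u + create l (annihilate x f) u.
Proof.
apply/funext => u; rewrite -[u in LHS](deleteK ord0) annihilate_insert0.
rewrite /create insert_at insertK deleteK; congr (_ + _).
by rewrite mulr_sumr; apply: eq_bigr => s _; rewrite insert_at insertK.
Qed.

Lemma annihilate_sum T (I : finType) x (c : I -> C) (F : I -> word T.+1 -> C) :
  annihilate x (fun w => \sum_i c i * F i w) =
  fun u => \sum_i c i * annihilate x (F i) u.
Proof.
apply/funext => u; rewrite /annihilate exchange_big.
by apply: eq_bigr => i _; rewrite mulr_sumr.
Qed.

Lemma fock_form_sumr T (I : finType) (c : I -> C) g (F : I -> word T -> C) :
  fock_form g (fun w => \sum_i c i * F i w) = \sum_i c i * fock_form g (F i).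
Proof.
elim: T g F => [|T IH] g F /=.
  under eq_bigr do rewrite mulr_sumr; rewrite exchange_big /=.
  by apply: eq_bigr => i _; rewrite mulr_sumr; apply: eq_bigr => w _; ring.
under eq_bigr do rewrite annihilate_sum IH; rewrite exchange_big /=.
by apply: eq_bigr => i _; rewrite mulr_sumr.
Qed.

Lemma fock_form_conj T (f g : word T -> C) : (fock_form f g)^* = fock_form g f.
Proof.
elim: T f g => [|T IH] f g /=; rewrite rmorph_sum; apply: eq_bigr => w _.
  by rewrite rmorphM /= conjCK mulrC.
exact: IH.
Qed.

Lemma fock_form_suml T (I : finType) (c : I -> C) g (F : I -> word T -> C) :
  fock_form (fun w => \sum_i c i * F i w) g =
  \sum_i (c i)^* * fock_form (F i) g.
Proof.
rewrite -fock_form_conj fock_form_sumr rmorph_sum; apply: eq_bigr => i _.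
by rewrite rmorphM /= fock_form_conj.
Qed.

Lemma fock_formPr T (f g h : word T -> C) c :
  fock_form f (fun w => c * g w + h w) = c * fock_form f g + fock_form f h.
Proof.
pose F (b : bool) := if b then g else h.
rewrite (_ : (fun w => _) = fun w => \sum_b (if b then c else 1) * F b w).
  by rewrite fock_form_sumr big_bool /= mul1r.
by apply/funext => w; rewrite big_bool /= mul1r.
Qed.

Lemma fock_formZr T (f g : word T -> C) c :
  fock_form f (fun w => c * g w) = c * fock_form f g.
Proof.
rewrite (_ : (fun w => _) = fun w => \sum_(i < 1) c * g w).
  by rewrite fock_form_sumr big_ord1.
by apply/funext => w; rewrite big_ord1.
Qed.

Lemma fock_formPl T (f g h : word T -> C) c :
  fock_form (fun w => c * g w + h w) f = c^* * fock_form g f + fock_form h f.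
Proof.
by rewrite -fock_form_conj fock_formPr rmorphD rmorphM /= !fock_form_conj.
Qed.

Lemma fock_formZl T (f g : word T -> C) c :
  fock_form (fun w => c * g w) f = c^* * fock_form g f.
Proof. by rewrite -fock_form_conj fock_formZr rmorphM /= !fock_form_conj. Qed.

Lemma fock_form_ge0 T (f : word T -> C) : 0 <= fock_form f f.
Proof.
elim: T f => [|T IH] f /=; apply: sumr_ge0 => // w _.
by rewrite -normCKC exprn_ge0.
Qed.

Lemma fock_form_creater T l g (f : word T -> C) :
  fock_form g (create l f) =
  T.+1%:R * \sum_y l y * fock_form (annihilate y g) f.
Proof.
elim: T g f => [|T IH] g f.
  rewrite mul1r fock_formS; apply: eq_bigr => x _.
  by rewrite annihilate_create0 fock_formZr.
rewrite fock_formS.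
under eq_bigr do rewrite annihilate_create fock_formPr IH.
rewrite big_split /= -mulr_sumr exchange_big /=.
rewrite [X in _ + _ * X](_ : _ = \sum_y l y * fock_form (annihilate y g) f).
  by rewrite -[T.+2%:R]natr1 mulrDl mul1r addrC.
apply: eq_bigr => y _; rewrite -mulr_sumr fock_formS; congr (_ * _).
by apply: eq_bigr => x _; rewrite annihilateC.
Qed.

Lemma fock_form_createl T l (f : word T -> C) g :
  fock_form (create l f) g =
  T.+1%:R * \sum_y (l y)^* * fock_form f (annihilate y g).
Proof.
rewrite -fock_form_conj fock_form_creater rmorphM rmorph_nat rmorph_sum /=.
by congr (_ * _); apply: eq_bigr => y _; rewrite rmorphM /= fock_form_conj.
Qed.

(* [a a^* = |l|^2 + a^* a], and the last term is nonnegative. *)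
Lemma fock_form_create_ge T l (f : word T -> C) :
  T.+1%:R * (\sum_x `|l x| ^+ 2) * fock_form f f <=
  fock_form (create l f) (create l f).
Proof.
rewrite fock_form_creater -mulrA ler_pM2l ?ltr0Sn // mulr_suml.
case: T f => [|T] f.
  rewrite ler_sum // => x _.
  by rewrite annihilate_create0 fock_formZl mulrA normCK.
under [leRHS]eq_bigr do
  rewrite annihilate_create fock_formPl mulrDr mulrA -normCK.
rewrite big_split lerDl.
pose a w := \sum_y (l y)^* * annihilate y f w.
rewrite (_ : \sum_y _ = T.+1%:R * fock_form a a) ?mulr_ge0 ?fock_form_ge0 //.
rewrite /a fock_form_suml mulr_sumr; apply: eq_bigr => y _.
by rewrite fock_form_createl conjCK mulrCA fock_form_sumr.
Qed.

Lemma fock_form_prod_ge T (L : 'I_T -> X -> C) :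
  let f := fun w : word T => \prod_t L t (w t) in
  T`!%:R * \prod_t \sum_x `|L t x| ^+ 2 <= fock_form f f.
Proof.
elim: T L => [|T IH] L /=.
  by rewrite fact0 mul1r /= big_word0 !big_ord0 conjC1 mulr1.
rewrite (_ : (fun w : word T.+1 => _) =
    create (L ord0) (fun u : word T => \prod_t L (lift ord0 t) (u t)));
  last first.
  apply/funext => w; rewrite big_ord_recl; congr (_ * _).
  by apply: eq_bigr => t _; rewrite ffunE.
apply: le_trans (fock_form_create_ge _ _).
rewrite big_ord_recl factS natrM -!mulrA ler_pM2l ?ltr0Sn // mulrCA.
rewrite ler_wpM2l ?IH //.
by apply: sumr_ge0 => x _; rewrite exprn_ge0.
Qed.

End Fock.

(** * Positive semidefinite matrices and kernels *)

Lemma sum_delta (R : pzSemiRingType) (I : finType) (i : I) (F : I -> R) :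
  \sum_j (j == i)%:R * F j = F i.
Proof.
by under eq_bigr do rewrite mulr_natl mulrb; rewrite -big_mkcond big_pred1_eq.
Qed.

Lemma comm_diag_mx_map (F : idomainType) n (A : 'M[F]_n) (D : 'rV_n)
    (f : F -> F) :
  comm_mx A (diag_mx D) -> comm_mx A (diag_mx (map_mx f D)).
Proof.
move=> AD; apply/matrixP => i j; move/matrixP/(_ i j): AD.
rewrite !mul_mx_diag !mul_diag_mx !mxE.
have [->|nz] := eqVneq (A i j) 0; first by rewrite !mulr0 !mul0r.
by rewrite mulrC => /(mulIf nz) ->; rewrite mulrC.
Qed.

Section Psd.
Local Open Scope sesquilinear_scope.
Variable C : numClosedFieldType.

Definition frobenius_sq m n (A : 'M[C]_(m, n)) := \sum_i \sum_j `|A i j| ^+ 2.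

(* [psd] over an arbitrary numerically closed field. *)
Definition psdmx n (B : 'M[C]_n) :=
  forall v : 'cV[C]_n, 0 <= (v ^t* *m B *m v) 0 0.

Lemma trmxCM m n p (A : 'M[C]_(m, n)) (B : 'M[C]_(n, p)) :
  (A *m B) ^t* = B ^t* *m A ^t*.
Proof. by rewrite trmx_mul map_mxM. Qed.

Lemma trmxCD m n (A B : 'M[C]_(m, n)) : (A + B) ^t* = A ^t* + B ^t*.
Proof. by rewrite linearD map_mxD. Qed.

Lemma trmxCZ m n c (A : 'M[C]_(m, n)) : (c *: A) ^t* = c^* *: A ^t*.
Proof. by rewrite linearZ map_mxZ. Qed.

Lemma trmxC_delta m n (i : 'I_m) (j : 'I_n) :
  (delta_mx i j : 'M[C]_(m, n)) ^t* = delta_mx j i.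
Proof. by rewrite trmx_delta map_delta_mx. Qed.

Lemma unitarymx_mull n (V M : 'M[C]_n) : V \is unitarymx ->
  (V *m M \is unitarymx) = (M \is unitarymx).
Proof.
move=> uV; apply/idP/idP => uM; last exact: mul_unitarymx.
rewrite -(mulKmx (unitarymx_unit uV) M).
by rewrite mul_unitarymx ?invmx_unitary ?trmxC_unitary.
Qed.

Lemma unitarymx_coord_le1 n (U : 'M[C]_n) i j :
  U \is unitarymx -> `|U i j| <= 1.
Proof.
move=> /unitarymxP/matrixP/(_ i i); rewrite !mxE eqxx => row_norm.
rewrite -(@ler_pXn2r _ 2) ?nnegrE // expr1n -[leRHS]/(true%:R) -row_norm.
rewrite (bigD1 j) //= !mxE -normCK lerDl.
by apply: sumr_ge0 => k _; rewrite !mxE -normCK exprn_ge0.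
Qed.

Lemma quad_formE n (B : 'M[C]_n) (v : 'cV[C]_n) :
  (v ^t* *m B *m v) 0 0 = \sum_i \sum_j (v i 0)^* * B i j * v j 0.
Proof.
rewrite mxE exchange_big; apply: eq_bigr => j _; rewrite mxE mulr_suml.
by apply: eq_bigr => i _; rewrite !mxE.
Qed.

Lemma quad_form_eq0 n (G : 'M[C]_n) :
  (forall v : 'cV[C]_n, (v ^t* *m G *m v) 0 0 = 0) -> G = 0.
Proof.
move=> G0; apply/matrixP => i j; rewrite mxE.
have Gd k : G k k = 0.
  by rewrite -(G0 (delta_mx k 0)) trmxC_delta -rowE -colE !mxE.
have polar c : c * G i j + c^* * G j i = 0.
  have := G0 (delta_mx i 0 + c *: delta_mx j 0).
  rewrite trmxCD trmxCZ !trmxC_delta.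
  rewrite !(mulmxDl, mulmxDr) -!(scalemxAl, scalemxAr) -!rowE -!colE !mxE !Gd.
  by rewrite !mulr0 add0r addr0 addrC.
have /eqP := polar 'i; rewrite conjCi mulNr -mulrBr mulf_eq0 (negPf (neq0Ci C)).
rewrite subr_eq0 => /eqP Gsym; have := polar 1.
by rewrite conjC1 !mul1r -Gsym -mulr2n => /eqP; rewrite mulrn_eq0 => /eqP.
Qed.

Lemma psdmx_herm n (B : 'M[C]_n) : psdmx B -> B ^t* = B.
Proof.
move=> pB; apply: subr0_eq; apply: quad_form_eq0 => v.
have qC : (v ^t* *m B ^t* *m v) 0 0 = (v ^t* *m B *m v) 0 0.
  rewrite -[RHS](geC0_conj (pB v)).
  transitivity ((v ^t* *m B *m v) ^t* 0 0); last by rewrite [LHS]mxE mxE.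
  by rewrite !trmxCM trmxCK mulmxA.
by rewrite mulmxBr mulmxBl [LHS]mxE [X in _ + X]mxE qC subrr.
Qed.

(* Every [v v^*] is a multiple of a projection. *)
Lemma mxtrace_proj_eq0 n (G : 'M[C]_n) :
  (forall P : 'M[C]_n, P ^t* = P -> P *m P = P -> \tr (P *m G) = 0) -> G = 0.
Proof.
move=> PG; apply: quad_form_eq0 => v; have [->|v0] := eqVneq v 0.
  by rewrite mulmx0 mxE.
pose N := \sum_i `|v i 0| ^+ 2.
have vv : v ^t* *m v = N%:M.
  rewrite [LHS]mx11_scalar mxE; congr _%:M; apply: eq_bigr => i _.
  by rewrite !mxE normCKC.
have N_ge0 : 0 <= N by apply: sumr_ge0 => i _; rewrite exprn_ge0.
have N_neq0 : N != 0.
  apply: contraNneq v0 => /psumr_eq0P vi; apply/eqP/matrixP => i j.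
  rewrite (ord1 j) mxE; apply/eqP; rewrite -normr_eq0 -sqrf_eq0.
  by rewrite vi // => k _; rewrite exprn_ge0.
have := PG (N^-1 *: (v *m v ^t*)).
rewrite trmxCZ trmxCM trmxCK fmorphV /= (geC0_conj N_ge0) => /(_ erefl).
rewrite -scalemxAl -scalemxAr mulmxA -(mulmxA v) vv mul_mx_scalar -scalemxAl.
rewrite scalerA mulVf // scale1r => /(_ erefl) /eqP.
rewrite -scalemxAl mxtraceZ mulf_eq0 invr_eq0 (negPf N_neq0) /= -mulmxA.
by rewrite mxtrace_mulC trace_mx11 => /eqP.
Qed.

Lemma psdmx_spectral n (B : 'M[C]_n) : psdmx B ->
  exists P : 'M[C]_n, exists D : 'rV[C]_n,
    [/\ P \is unitarymx, forall i, 0 <= D 0 i & B = P ^t* *m diag_mx D *m P].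
Proof.
move=> pB.
have /hermitian_normalmx/orthomx_spectralP eB : B \is hermsymmx.
  by apply/is_hermitianmxP; rewrite expr0 scale1r psdmx_herm.
move: eB; have := spectral_unitarymx B.
move: (spectralmx B) (spectral_diag B) => P D uP.
rewrite invmx_unitary // => eB.
exists P, D; split => // i; have := pB (P ^t* *m delta_mx i 0).
rewrite trmxCM trmxCK eB !mulmxA mulmxtVK // -!mulmxA (mulmxA P).
by rewrite (unitarymxP uP) mul1mx trmxC_delta mulmxA -rowE -colE !mxE eqxx.
Qed.

Lemma psdmx_sqrt n (B : 'M[C]_n) : psdmx B ->
  exists S : 'M[C]_n, [/\ S ^t* = S, S *m S = B &
    forall A, comm_mx A B -> comm_mx A S].
Proof.
move=> /psdmx_spectral[P [D [uP D_ge0 ->]]].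
have PP := mulmx1C (unitarymxP uP).
pose E := diag_mx (map_mx sqrtC D).
have EC : E ^t* = E.
  apply/matrixP => i j; rewrite !mxE eq_sym; case: eqVneq => [->|_].
    by rewrite !mulr1n geC0_conj ?sqrtC_ge0.
  by rewrite !mulr0n conjC0.
have EE : E *m E = diag_mx D.
  rewrite mulmx_diag; congr diag_mx; apply/rowP => i.
  by rewrite !mxE -expr2 sqrtCK.
exists (P ^t* *m E *m P); split=> [||A AB].
- by rewrite !trmxCM trmxCK EC mulmxA.
- by rewrite !mulmxA mulmxtVK // -(mulmxA (P ^t*) E) EE.
have : comm_mx (P *m A *m P ^t*) E.
  apply: comm_diag_mx_map; move/(congr1 (fun M => P *m M *m P ^t*)): AB.
  by rewrite /comm_mx !mulmxA mulmxtVK // (unitarymxP uP) mul1mx.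
move/(congr1 (fun M => P ^t* *m M *m P)).
by rewrite /comm_mx !mulmxA !PP !mul1mx -!mulmxA PP mulmx1.
Qed.

Lemma psdmx_mul n (A B : 'M[C]_n) : psdmx A -> psdmx B ->
  (A *m B) ^t* = A *m B -> psdmx (A *m B).
Proof.
move=> pA pB; rewrite trmxCM !psdmx_herm // => BA v.
have [S [SC SS SA]] := psdmx_sqrt pB.
have -> : A *m B = S *m A *m S by rewrite -SS mulmxA (SA A (esym BA)).
by have := pA (S *m v); rewrite trmxCM SC !mulmxA.
Qed.

Section Kernels.
Variable W : finType.
Implicit Types (K L : W -> W -> C) (f g : W -> C).

Definition kernel_form K f g := \sum_w \sum_z (f w)^* * K w z * g z.

Definition psd_kernel K := forall f, 0 <= kernel_form K f f.

Definition kernel_comp K L w z := \sum_y K w y * L y z.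

Definition kernel_mx K : 'M[C]_#|W| :=
  \matrix_(i, j) K (enum_val i) (enum_val j).

Lemma sum_enum_val (F : W -> C) : \sum_w F w = \sum_(i < #|W|) F (enum_val i).
Proof. by rewrite -[RHS](big_enum_val (A := W)). Qed.

Lemma kernel_mx_comp K L :
  kernel_mx (kernel_comp K L) = kernel_mx K *m kernel_mx L.
Proof.
apply/matrixP => i j; rewrite !mxE /kernel_comp sum_enum_val.
by apply: eq_bigr => k _; rewrite !mxE.
Qed.

Lemma kernel_mx_herm K :
  (kernel_mx K) ^t* = kernel_mx K <-> forall w z, (K w z)^* = K z w.
Proof.
split=> [/matrixP KC w z|KC]; last by apply/matrixP => i j; rewrite !mxE KC.
by have := KC (enum_rank z) (enum_rank w); rewrite !mxE !enum_rankK.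
Qed.

Lemma psd_kernelP K : psd_kernel K <-> psdmx (kernel_mx K).
Proof.
have formE f (u : 'cV[C]_#|W|) : (forall i, u i 0 = f (enum_val i)) ->
    (u ^t* *m kernel_mx K *m u) 0 0 = kernel_form K f f.
  move=> uf; rewrite quad_formE /kernel_form sum_enum_val.
  apply: eq_bigr => i _; rewrite sum_enum_val; apply: eq_bigr => j _.
  by rewrite mxE !uf.
split=> [pK u|pK f].
  by rewrite (formE (fun w => u (enum_rank w) 0)) // => i; rewrite enum_valK.
by rewrite -(formE f (\col_i f (enum_val i))) // => i; rewrite mxE.
Qed.

Lemma psd_kernel_herm K : psd_kernel K -> forall w z, (K w z)^* = K z w.
Proof. by move/psd_kernelP/psdmx_herm/kernel_mx_herm. Qed.

Lemma psd_kernel_comp K L : psd_kernel K -> psd_kernel L ->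
  (forall w z, (kernel_comp K L w z)^* = kernel_comp K L z w) ->
  psd_kernel (kernel_comp K L).
Proof.
move=> /psd_kernelP pK /psd_kernelP pL /kernel_mx_herm.
rewrite kernel_mx_comp => KL; apply/psd_kernelP; rewrite kernel_mx_comp.
exact: psdmx_mul.
Qed.

Lemma kernel_form_sum (I : finType) (P : pred I) (K : I -> W -> W -> C) f g :
  kernel_form (fun w z => \sum_(i | P i) K i w z) f g =
  \sum_(i | P i) kernel_form (K i) f g.
Proof.
rewrite [RHS]exchange_big; apply: eq_bigr => w _; rewrite [RHS]exchange_big.
by apply: eq_bigr => z _; rewrite mulr_sumr mulr_suml.
Qed.

Lemma kernel_form_suml (I : finType) K (F : I -> W -> C) g :
  kernel_form K (fun w => \sum_i F i w) g = \sum_i kernel_form K (F i) g.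
Proof.
rewrite [RHS]exchange_big; apply: eq_bigr => w _; rewrite [RHS]exchange_big.
by apply: eq_bigr => z _; rewrite rmorph_sum !mulr_suml.
Qed.

Lemma kernel_form_sumr (I : finType) K f (G : I -> W -> C) :
  kernel_form K f (fun z => \sum_i G i z) = \sum_i kernel_form K f (G i).
Proof.
rewrite [RHS]exchange_big; apply: eq_bigr => w _; rewrite [RHS]exchange_big.
by apply: eq_bigr => z _; rewrite mulr_sumr.
Qed.

Lemma psd_kernel_sum (I : finType) (P : pred I) (K : I -> W -> W -> C) :
  (forall i, P i -> psd_kernel (K i)) ->
  psd_kernel (fun w z => \sum_(i | P i) K i w z).
Proof.
by move=> pK f; rewrite kernel_form_sum; apply: sumr_ge0 => i Pi; apply: pK.
Qed.

(* The form is half the sum of [|f w - f (s w)|^2]. *)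
Lemma psd_kernel_involution (s : W -> W) : involutive s ->
  psd_kernel (fun w z => (z == w)%:R - (z == s w)%:R).
Proof.
move=> sK f; rewrite -(pmulr_rge0 _ (ltr0Sn _ 1)).
pose cross w z := (f w)^* * f z.
have formE : kernel_form (fun w z => (z == w)%:R - (z == s w)%:R) f f =
    \sum_w cross w w - \sum_w cross w (s w).
  rewrite -sumrB; apply: eq_bigr => w _.
  rewrite -[cross w w]sum_delta -[cross w (s w)]sum_delta -sumrB.
  by apply: eq_bigr => z _; rewrite /cross; ring.
have flip (F : W -> W -> C) : \sum_w F w (s w) = \sum_w F (s w) w.
  by rewrite (reindex_inj (inv_inj sK)); apply: eq_bigr => w _; rewrite sK.
rewrite (_ : 2%:R * _ = \sum_w `|f w - f (s w)| ^+ 2).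
  by apply: sumr_ge0 => w _; rewrite exprn_ge0.
rewrite formE mulr_natl mulr2n {2}(reindex_inj (inv_inj sK)) {2}flip.
rewrite -!sumrB -big_split; apply: eq_bigr => w _.
by rewrite normCKC rmorphB /cross /=; ring.
Qed.

End Kernels.
End Psd.

(** * Moments of an invariant mean on the unitary group *)

(* [test] plays the role of the integrable functions. *)
Record haar_mean (C : numClosedFieldType) (d : nat)
    (test : ('M[C]_d -> C) -> Prop) (E : ('M[C]_d -> C) -> C) : Prop := {
  test_cst : forall c, test (fun=> c);
  test_coord : forall i j, test (fun U => U i j);
  testD : forall F G, test F -> test G -> test (fun U => F U + G U);
  testM : forall F G, test F -> test G -> test (fun U => F U * G U);
  test_conj : forall F, test F -> test (fun U => (F U)^*);
  mean1 : E (fun=> 1) = 1;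
  mean_linear : forall c F G, test F -> test G ->
    E (fun U => c * F U + G U) = c * E F + E G;
  eq_mean : forall F G, (forall U, U \is unitarymx -> F U = G U) -> E F = E G;
  mean_ge0 : forall F, test F ->
    (forall U, U \is unitarymx -> 0 <= F U) -> 0 <= E F;
  mean_invariant : forall F V, test F -> V \is unitarymx ->
    E (fun U => F (V *m U)) = E F }.

Section UnitCircle.
Local Open Scope sesquilinear_scope.
Variable C : numClosedFieldType.

(* The Cayley transforms [(k + i) / (k - i)] are infinitely many roots. *)
Lemma poly_unit_circle_eq0 (p : {poly C}) :
  (forall z, `|z| = 1 -> p.[z] = 0) -> p = 0.
Proof.
move=> pz; pose z (k : nat) : C := (k%:R + 'i) / (k%:R - 'i).
have zC k : k%:R - 'i = (k%:R + 'i : C)^*.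
  by rewrite rmorphD rmorph_nat /= conjCi.
have z_neq0 k : k%:R + 'i != 0 :> C.
  rewrite addr_eq0; apply: contraNneq (nonRealCi C) => /(congr1 -%R).
  by rewrite opprK => <-; rewrite rpredN realn.
have zi_neq0 k : k%:R - 'i != 0 :> C by rewrite zC conjC_eq0.
have z_inj : injective z.
  move=> k l /eqP; rewrite eqr_div // => /eqP cross_eq.
  have /eqP : (l%:R - k%:R) * (2 * 'i) = 0 :> C.
    rewrite -[RHS](subrr ((k%:R + 'i) * (l%:R - 'i))) {2}cross_eq; ring.
  rewrite !mulf_eq0 pnatr_eq0 (negPf (neq0Ci C)) !orbF subr_eq0 eqr_nat.
  by move=> /eqP ->.
apply/eqP; apply: contraT => p_neq0.
have := @max_poly_roots _ p [seq z k | k <- iota 0 (size p)] p_neq0.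
rewrite (map_inj_uniq z_inj) iota_uniq size_map size_iota ltnn => -> //.
apply/allP => _ /mapP[k _ ->]; rewrite rootE pz //.
by rewrite normf_div zC norm_conjC divff // normr_eq0.
Qed.

Lemma eq_sum_set1_circle (I : finType) (a b : {set I} -> C) :
  (forall z, `|z| = 1 ->
    \sum_(J : {set I}) (z - 1) ^+ #|J| * a J =
    \sum_(J : {set I}) (z - 1) ^+ #|J| * b J) ->
  \sum_i a [set i] = \sum_i b [set i].
Proof.
move=> ab; pose p : {poly C} := \sum_(J : {set I}) (a J - b J) *: 'X^#|J|.
have p0 : p = 0.
  rewrite -(comp_polyXaddC_K p (-1)) polyCN.
  rewrite [p \Po _]poly_unit_circle_eq0 ?comp_poly0 // => z z1.
  rewrite horner_comp !hornerE /p horner_sum.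
  under eq_bigr do rewrite hornerZ hornerXn mulrC mulrBr.
  by rewrite sumrB ab ?subrr.
apply/eqP; rewrite -subr_eq0 -sumrB -(big_cards1 _ (fun J => a J - b J)).
rewrite -[X in _ == X](coef0 _ 1) -p0 coef_sum big_mkcond.
by apply/eqP/eq_bigr => J _; rewrite coefZ coefXn eq_sym mulr_natr mulrb.
Qed.

Lemma proj_pencil_unitary d (P : 'M[C]_d) z :
  P ^t* = P -> P *m P = P -> `|z| = 1 -> 1%:M + (z - 1) *: P \is unitarymx.
Proof.
move=> PC PP z1; apply/unitarymxP.
rewrite trmxCD trmxCZ trmx1 map_mx1 PC mulmxDl !mulmxDr !mul1mx mulmx1.
rewrite -scalemxAl -scalemxAr PP scalerA -addrA -!scalerDl rmorphB /= conjC1.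
rewrite (_ : _ + _ = z * z^* - 1); last by ring.
by rewrite -normCK z1 expr1n subrr scale0r addr0.
Qed.

End UnitCircle.

Section TestFunctions.
Variables (C : numClosedFieldType) (d : nat).
Variables (test : ('M[C]_d -> C) -> Prop) (E : ('M[C]_d -> C) -> C).
Hypothesis haarE : haar_mean test E.

Lemma test_sum (I : Type) (r : seq I) (P : pred I) (F : I -> 'M[C]_d -> C) :
  (forall i, test (F i)) -> test (fun U => \sum_(i <- r | P i) F i U).
Proof.
move=> tF; elim: r => [|i r IH].
  by under eq_fun do rewrite big_nil; exact: test_cst haarE 0.
by under eq_fun do rewrite big_cons; case: (P i) => //; apply: (testD haarE).
Qed.

Lemma test_prod (I : Type) (r : seq I) (P : pred I) (F : I -> 'M[C]_d -> C) :
  (forall i, test (F i)) -> test (fun U => \prod_(i <- r | P i) F i U).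
Proof.
move=> tF; elim: r => [|i r IH].
  by under eq_fun do rewrite big_nil; exact: test_cst haarE 1.
by under eq_fun do rewrite big_cons; case: (P i) => //; apply: (testM haarE).
Qed.

Lemma testZ c F : test F -> test (fun U => c * F U).
Proof. by apply: (testM haarE); exact: (test_cst haarE). Qed.

Lemma test_conjM F G : test F -> test G -> test (fun U => (F U)^* * G U).
Proof.
by move=> tF tG; apply: (testM haarE) => //; exact: (test_conj haarE).
Qed.

Lemma test_sqr_norm F : test F -> test (fun U => `|F U| ^+ 2).
Proof. by move=> tF; under eq_fun do rewrite normCKC; exact: test_conjM. Qed.

Lemma test_mull (A : 'M[C]_d) i j : test (fun U => (A *m U) i j).
Proof.
under eq_fun do rewrite mxE; apply: test_sum => k.
by apply: testZ; exact: (test_coord haarE).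
Qed.

Lemma test_mxtrace (A : 'M[C]_d) : test (fun U => \tr (U *m A)).
Proof.
under eq_fun do rewrite mxtrace_mulC.
by apply: test_sum => i; exact: test_mull.
Qed.

Lemma mean0 : E (fun=> 0) = 0.
Proof.
have t0 := test_cst haarE 0; have := mean_linear haarE (-1) t0 t0.
by under eq_fun do rewrite mulr0 addr0; rewrite mulN1r addNr.
Qed.

Lemma meanZ c F : test F -> E (fun U => c * F U) = c * E F.
Proof.
move=> tF; have := mean_linear haarE c tF (test_cst haarE 0).
by under eq_fun do rewrite addr0; rewrite mean0 addr0.
Qed.

Lemma meanD F G : test F -> test G -> E (fun U => F U + G U) = E F + E G.
Proof.
move=> tF tG; have := mean_linear haarE 1 tF tG.
by under eq_fun do rewrite mul1r; rewrite mul1r.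
Qed.

Lemma mean_sum (I : finType) (P : pred I) (F : I -> 'M[C]_d -> C) :
  (forall i, test (F i)) ->
  E (fun U => \sum_(i | P i) F i U) = \sum_(i | P i) E (F i).
Proof.
move=> tF; elim: (index_enum I) => [|i r IH].
  by under eq_fun do rewrite big_nil; rewrite big_nil mean0.
under eq_fun do rewrite big_cons; rewrite big_cons -IH; case: (P i) => //.
by rewrite meanD //; exact: test_sum.
Qed.

End TestFunctions.

Section RowOperations.
Variables (A B : finType) (T : nat).
Local Notation word := (word (A * B)%type).
Implicit Types (w : word T.+1) (s t r : 'I_T.+1) (a : A).

Definition replace_row w t a : word T.+1 := insert t (a, (w t).2) (delete t w).

Definition swap_rows s t w : word T.+1 :=
  replace_row (replace_row w s (w t).1) t (w s).1.

Lemma replace_row_at w t a : replace_row w t a t = (a, (w t).2).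
Proof. exact: insert_at. Qed.

Lemma replace_row_neq w t a r : r != t -> replace_row w t a r = w r.
Proof. exact: insert_neq. Qed.

Lemma replace_rowK w t a : replace_row (replace_row w t a) t (w t).1 = w.
Proof.
apply/ffunP => r; have [->|rt] := eqVneq r t; last by rewrite !replace_row_neq.
by rewrite !replace_row_at; case: (w t).
Qed.

Lemma swap_rowsE s t w r : s != t ->
  swap_rows s t w r = if r == s then ((w t).1, (w s).2)
                      else if r == t then ((w s).1, (w t).2) else w r.
Proof.
move=> st; rewrite /swap_rows; have [->|rs] := eqVneq r s.
  by rewrite replace_row_neq // replace_row_at.
have [->|rt] := eqVneq r t; last by rewrite !replace_row_neq.
by rewrite replace_row_at replace_row_neq // eq_sym.
Qed.

Lemma swap_rowsK s t : s != t -> involutive (swap_rows s t).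
Proof.
move=> st w; apply/ffunP => r; rewrite !(swap_rowsE _ _ st) !eqxx.
rewrite [t == s]eq_sym (negPf st).
have [->|_] := eqVneq r s; first by case: (w s).
by have [->|_] := eqVneq r t; first by case: (w t).
Qed.

End RowOperations.

Section Moments.
Local Open Scope sesquilinear_scope.
Variables (C : numClosedFieldType) (d : nat).
Variables (test : ('M[C]_d -> C) -> Prop) (E : ('M[C]_d -> C) -> C).
Hypothesis haarE : haar_mean test E.
Local Notation word := (word ('I_d * 'I_d)%type).

Definition monomial T (w : word T) (U : 'M[C]_d) : C :=
  \prod_t U (w t).1 (w t).2.

Definition mixed_monomial T (A : 'M[C]_d) (J : {set 'I_T}) (w : word T)
    (U : 'M[C]_d) : C :=
  \prod_t (if t \in J then A *m U else U) (w t).1 (w t).2.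

Definition moment T (w z : word T) : C :=
  E (fun U => (monomial w U)^* * monomial z U).

Lemma test_mixed_monomial T A J (w : word T) : test (mixed_monomial A J w).
Proof.
apply: (test_prod haarE) => t.
by case: (t \in J); [exact: (test_mull haarE)|exact: (test_coord haarE)].
Qed.

Lemma test_monomial T (w : word T) : test (monomial w).
Proof. by apply: (test_prod haarE) => t; exact: (test_coord haarE). Qed.

Lemma test_moment T (w z : word T) :
  test (fun U => (monomial w U)^* * monomial z U).
Proof. by apply: (test_conjM haarE); exact: test_monomial. Qed.

Lemma monomial_insert T (s : 'I_T.+1) x (u : word T) U :
  monomial (insert s x u) U = U x.1 x.2 * monomial u U.
Proof.
rewrite /monomial (bigD1_ord s) //= insert_at; congr (_ * _).
by apply: eq_bigr => t _; rewrite insert_lift.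
Qed.

Lemma monomial_pencil T (w : word T) A e U :
  monomial w ((1%:M + e *: A) *m U) =
  \sum_(J : {set 'I_T}) e ^+ #|J| * mixed_monomial A J w U.
Proof.
have pencilE t : ((1%:M + e *: A) *m U) (w t).1 (w t).2 =
    e * (A *m U) (w t).1 (w t).2 + U (w t).1 (w t).2.
  by rewrite mulmxDl mul1mx -scalemxAl [LHS]mxE [X in _ + X]mxE addrC.
rewrite /monomial (eq_bigr _ (fun t _ => pencilE t)) bigA_distr.
apply: eq_bigr => J _.
rewrite -prodr_const [X in _ = X * _]big_mkcond -big_split.
by apply: eq_bigr => t _ /=; case: (t \in J); rewrite ?mul1r.
Qed.

Lemma mixed_monomial_set1 T A (w : word T.+1) t U :
  mixed_monomial A [set t] w U =
  \sum_a A (w t).1 a * monomial (replace_row w t a) U.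
Proof.
rewrite /mixed_monomial (bigD1_ord t) //= inE eqxx mxE mulr_suml.
apply: eq_bigr => a _; rewrite monomial_insert mulrA; congr (_ * _).
by apply: eq_bigr => r _; rewrite inE eq_sym (negPf (neq_lift _ _)) ffunE.
Qed.

(* The coefficient of [c - 1] in the invariance of [E] along the unitaries
   [1 + (c - 1) P], where [|c| = 1]. *)
Lemma mean_derivation_proj T (P : 'M[C]_d) (w z : word T) :
  P ^t* = P -> P *m P = P ->
  \sum_t E (fun U => (monomial w U)^* * mixed_monomial P [set t] z U) =
  \sum_t E (fun U => (mixed_monomial P [set t] w U)^* * monomial z U).
Proof.
move=> PC PP.
pose a J := E (fun U => (monomial w U)^* * mixed_monomial P J z U).
pose b J := E (fun U => (mixed_monomial P J w U)^* * monomial z U).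
apply: (eq_sum_set1_circle (a := a) (b := b)) => c c1; rewrite /a /b.
have ta J := test_conjM haarE (test_monomial w) (test_mixed_monomial P J z).
have tb J := test_conjM haarE (test_mixed_monomial P J w) (test_monomial z).
under eq_bigr do rewrite -(meanZ haarE) //.
under [RHS]eq_bigr do rewrite -(meanZ haarE) //.
rewrite -!(mean_sum haarE) => [|J|J]; [|exact: (testZ haarE)..].
pose V := 1%:M + (c - 1) *: P.
have uV : V \is unitarymx by exact: proj_pencil_unitary.
have VC : V ^t* = 1%:M + (c^* - 1) *: P.
  by rewrite trmxCD trmxCZ trmx1 map_mx1 PC rmorphB /= conjC1.
have tV : test (fun U => (monomial w (V ^t* *m U))^* * monomial z U).
  apply: (test_conjM haarE) (test_monomial z).
  by apply: (test_prod haarE) => t; exact: (test_mull haarE).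
transitivity (E (fun U =>
    (monomial w (V ^t* *m (V *m U)))^* * monomial z (V *m U))).
  apply: (eq_mean haarE) => U _.
  rewrite mulmxA (mulmx1C (unitarymxP uV)) mul1mx.
  by rewrite monomial_pencil mulr_sumr; apply: eq_bigr => J _; rewrite mulrCA.
rewrite (mean_invariant haarE tV uV); apply: (eq_mean haarE) => U _.
rewrite VC monomial_pencil rmorph_sum mulr_suml; apply: eq_bigr => J _.
by rewrite rmorphM rmorphXn rmorphB /= conjCK conjC1 mulrA.
Qed.

Lemma mean_mixed_monomialr T A (w z : word T.+1) t :
  E (fun U => (monomial w U)^* * mixed_monomial A [set t] z U) =
  \sum_a A (z t).1 a * moment w (replace_row z t a).
Proof.
under eq_fun do rewrite mixed_monomial_set1 mulr_sumr.
rewrite (mean_sum haarE) => [|a]; last first.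
  by apply: (test_conjM haarE); [|apply: (testZ haarE)]; exact: test_monomial.
apply: eq_bigr => a _; under eq_fun do rewrite mulrCA.
by rewrite (meanZ haarE) //; exact: test_moment.
Qed.

Lemma mean_mixed_monomiall T A (w z : word T.+1) t :
  E (fun U => (mixed_monomial A [set t] w U)^* * monomial z U) =
  \sum_a (A (w t).1 a)^* * moment (replace_row w t a) z.
Proof.
under eq_fun do rewrite mixed_monomial_set1 rmorph_sum mulr_suml.
rewrite (mean_sum haarE) => [|a]; last first.
  by apply: (test_conjM haarE); [apply: (testZ haarE)|]; exact: test_monomial.
apply: eq_bigr => a _; under eq_fun do rewrite rmorphM -mulrA.
by rewrite (meanZ haarE) //; exact: test_moment.
Qed.

Lemma sum_row_mxtrace T (A : 'M[C]_d) (r : 'I_T -> 'I_d)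
    (g : 'I_T -> 'I_d -> C) :
  \sum_t \sum_b A (r t) b * g t b =
  \tr (A *m \matrix_(b, a) \sum_t (r t == a)%:R * g t b).
Proof.
under [RHS]eq_bigr do rewrite mxE.
rewrite exchange_big [RHS]exchange_big; apply: eq_bigr => b _ /=.
under [RHS]eq_bigr do rewrite mxE mulr_sumr.
rewrite [RHS]exchange_big; apply: eq_bigr => t _ /=.
rewrite -(sum_delta (r t) (fun a => A a b * g t b)); apply: eq_bigr => a _.
by rewrite eq_sym mulrCA.
Qed.

Lemma moment_derivation T (w z : word T.+1) a b :
  \sum_t ((z t).1 == a)%:R * moment w (replace_row z t b) =
  \sum_t ((w t).1 == b)%:R * moment (replace_row w t a) z.
Proof.
pose L : 'M[C]_d := \matrix_(b, a)
  \sum_t ((z t).1 == a)%:R * moment w (replace_row z t b).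
pose G : 'M[C]_d := \matrix_(a, b)
  \sum_t ((w t).1 == b)%:R * moment (replace_row w t a) z.
suff /matrixP/(_ b a) : L - G^T = 0.
  by rewrite !mxE => /eqP; rewrite subr_eq0 => /eqP.
apply: mxtrace_proj_eq0 => P PC PP; rewrite mulmxBr linearB /=; apply/eqP.
rewrite subr_eq0 -[X in _ == X]mxtrace_tr trmx_mul trmxK.
rewrite [X in _ == X]mxtrace_mulC /L /G -!sum_row_mxtrace.
apply/eqP; have := mean_derivation_proj w z PC PP.
under eq_bigr do rewrite mean_mixed_monomialr.
under [RHS]eq_bigr do rewrite mean_mixed_monomiall.
move=> ->; apply: eq_bigr => t _; apply: eq_bigr => c _.
by rewrite -[in LHS]PC !mxE conjCK.
Qed.

Lemma sum_moment_replace_row T (w z : word T.+1) s t :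
  \sum_a moment (replace_row w s a) (replace_row z t a) =
  ((w s).2 == (z t).2)%:R * moment (delete s w) (delete t z).
Proof.
rewrite -(mean_sum haarE) => [|a]; last exact: test_moment.
rewrite -(meanZ haarE); last exact: test_moment.
apply: (eq_mean haarE) => U /unitarymxP/mulmx1C/matrixP/(_ (w s).2 (z t).2).
rewrite !mxE => <-; rewrite mulr_suml; apply: eq_bigr => a _.
by rewrite !monomial_insert rmorphM !mxE /=; ring.
Qed.

Definition gradient_kernel T (w z : word T.+1) : C :=
  \sum_s \sum_t (w s == z t)%:R * moment (delete s w) (delete t z).

(* Both sides are [sum_(a, b) <E_ab U_w, E_ab U_z>], where the matrix units
   [E_ab] act as derivations on the monomials [U_w]: moving [E_ab] across by
   invariance gives the left-hand side, contracting row indices by unitarity the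
   right-hand side. *)
Lemma casimir_moment T (w z : word T.+1) :
  (T.+1 * d)%:R * moment w z +
  \sum_s \sum_(t | t != s) moment (swap_rows s t w) z = gradient_kernel w z.
Proof.
rewrite natrM -mulrA mulr_natl -[X in _ *+ X]card_ord -sumr_const -big_split.
apply: eq_bigr => s _ /=.
transitivity (\sum_b \sum_t ((replace_row w s b t).1 == b)%:R *
    moment (replace_row (replace_row w s b) t (w s).1) z).
  rewrite exchange_big [RHS](bigD1 s) //=; congr (_ + _).
    under [RHS]eq_bigr do rewrite replace_rowK replace_row_at eqxx mul1r.
    by rewrite sumr_const card_ord mulr_natl.
  apply: eq_bigr => t ts.
  under [RHS]eq_bigr do rewrite (replace_row_neq _ _ ts) eq_sym.
  by rewrite sum_delta.
under [LHS]eq_bigr do rewrite -moment_derivation.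
rewrite exchange_big; apply: eq_bigr => t _ /=.
rewrite -mulr_sumr sum_moment_replace_row mulrA -natrM mulnb eq_sym.
by case: (w s) (z t) => [i j] [i' j'].
Qed.

Definition word_poly T (v : word T -> C) (U : 'M[C]_d) : C :=
  \sum_w v w * monomial w U.

Lemma test_word_poly T (v : word T -> C) : test (word_poly v).
Proof.
by apply: (test_sum haarE) => w; apply: (testZ haarE); exact: test_monomial.
Qed.

Lemma moment_formE T (v : word T -> C) :
  kernel_form (@moment T) v v = E (fun U => `|word_poly v U| ^+ 2).
Proof.
transitivity (E (fun U => \sum_w \sum_z
    (v w)^* * v z * ((monomial w U)^* * monomial z U))).
  have tvz w z := testZ haarE ((v w)^* * v z) (test_moment w z).
  rewrite (mean_sum haarE) => [|w]; last exact: (test_sum haarE).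
  apply: eq_bigr => w _; rewrite (mean_sum haarE) //; apply: eq_bigr => z _.
  by rewrite (meanZ haarE) 1?mulrAC //; exact: test_moment.
apply: (eq_mean haarE) => U _; rewrite normCKC rmorph_sum mulr_suml.
apply: eq_bigr => w _; rewrite mulr_sumr; apply: eq_bigr => z _.
by rewrite rmorphM /=; ring.
Qed.

Lemma psd_moment T : psd_kernel (@moment T).
Proof.
move=> v; rewrite moment_formE; apply: (mean_ge0 haarE) => [|U _].
  exact: (test_sqr_norm haarE) (test_word_poly v).
by rewrite exprn_ge0.
Qed.

Lemma gradient_kernel_herm T (w z : word T.+1) :
  (gradient_kernel w z)^* = gradient_kernel z w.
Proof.
rewrite /gradient_kernel rmorph_sum exchange_big; apply: eq_bigr => t _ /=.
rewrite rmorph_sum; apply: eq_bigr => s _.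
by rewrite rmorphM rmorph_nat /= (psd_kernel_herm (@psd_moment T)) eq_sym.
Qed.

Lemma gradient_kernel_form T (v : word T.+1 -> C) :
  kernel_form (@gradient_kernel T) v v =
  \sum_x kernel_form (@moment T) (annihilate x v) (annihilate x v).
Proof.
pose M s t (w z : word T.+1) :=
  (w s == z t)%:R * moment (delete s w) (delete t z).
have formM s t : kernel_form (M s t) v v =
    \sum_x kernel_form (@moment T) (v \o insert s x) (v \o insert t x).
  rewrite /kernel_form (big_word _ s).
  apply: eq_bigr => x _; apply: eq_bigr => u _.
  rewrite (big_word _ t) exchange_big; apply: eq_bigr => u' _ /=.
  rewrite -(sum_delta x (fun y =>
    (v (insert s x u))^* * moment u u' * v (insert t y u'))).
  by apply: eq_bigr => y _; rewrite /M !insert_at !insertK eq_sym; ring.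
rewrite (kernel_form_sum _ (fun s w z => \sum_t M s t w z)).
under eq_bigr do rewrite kernel_form_sum.
under eq_bigr do (under eq_bigr do rewrite formM; rewrite exchange_big).
rewrite exchange_big; apply: eq_bigr => x _ /=.
by rewrite kernel_form_suml; apply: eq_bigr => s _; rewrite kernel_form_sumr.
Qed.

Definition swap_laplacian T (w z : word T.+1) : C :=
  \sum_s \sum_(t | t != s) ((z == w)%:R - (z == swap_rows s t w)%:R).

Lemma psd_swap_laplacian T : psd_kernel (@swap_laplacian T).
Proof.
apply: psd_kernel_sum => s _; apply: psd_kernel_sum => t ts.
by apply: psd_kernel_involution; apply: swap_rowsK; rewrite eq_sym.
Qed.

Lemma swap_laplacian_moment T (w z : word T.+1) :
  kernel_comp (@swap_laplacian T) (@moment T.+1) w z =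
  (T.+1 * (d + T))%:R * moment w z - gradient_kernel w z.
Proof.
transitivity (\sum_s \sum_(t | t != s)
  (moment w z - moment (swap_rows s t w) z)).
  rewrite /kernel_comp; under eq_bigr do rewrite mulr_suml.
  rewrite exchange_big; apply: eq_bigr => s _ /=.
  under eq_bigr do rewrite mulr_suml.
  rewrite exchange_big; apply: eq_bigr => t _ /=.
  under eq_bigr do rewrite mulrBl.
  by rewrite sumrB !sum_delta.
under eq_bigr do rewrite sumrB sumr_const cardC1 card_ord.
rewrite sumrB sumr_const card_ord -casimir_moment -mulrnA.
by rewrite -[X in X - _]mulr_natl mulnDr natrD mulnC /=; ring.
Qed.

(* The swap Laplacian is positive and commutes with the moment kernel. *)
Lemma sum_moment_annihilate_le T (v : word T.+1 -> C) :
  \sum_x kernel_form (@moment T) (annihilate x v) (annihilate x v) <=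
  (T.+1 * (d + T))%:R * kernel_form (@moment T.+1) v v.
Proof.
rewrite -gradient_kernel_form -subr_ge0.
have : psd_kernel (kernel_comp (@swap_laplacian T) (@moment T.+1)).
  apply: psd_kernel_comp => [||w z].
  - exact: psd_swap_laplacian.
  - exact: psd_moment.
  rewrite !swap_laplacian_moment rmorphB rmorphM rmorph_nat /=.
  by rewrite (psd_kernel_herm (@psd_moment T.+1)) gradient_kernel_herm.
move/(_ v); congr is_true; congr (0 <= _).
rewrite mulr_sumr -sumrB; apply: eq_bigr => w _.
rewrite mulr_sumr -sumrB; apply: eq_bigr => z _.
by rewrite swap_laplacian_moment; ring.
Qed.

Lemma fock_form_le_moment T (v : word T -> C) :
  fock_form v v <=
  (T`! * \prod_(t < T) (d + t))%:R * kernel_form (@moment T) v v.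
Proof.
elim: T v => [|T IH] v.
  rewrite fact0 big_ord0 !mul1r /kernel_form /= !big_word0 /moment.
  under eq_fun do rewrite /monomial !big_ord0 conjC1 mul1r.
  by rewrite (mean1 haarE) mulr1.
rewrite fock_formS; apply: le_trans (ler_sum _ (fun x _ => IH _)) _.
rewrite -mulr_sumr.
apply: le_trans (ler_wpM2l (ler0n _ _) (sum_moment_annihilate_le v)) _.
by rewrite mulrA -natrM big_ord_recr factS /= mulnACA [(_ * T.+1)%N]mulnC.
Qed.

Lemma mean_prod_sqr_mxtrace_ge T (A : 'I_T -> 'M[C]_d) : (0 < d)%N ->
  \prod_t (frobenius_sq (A t) / (d + t)%:R) <=
  E (fun U => \prod_t `|\tr (U *m A t)| ^+ 2).
Proof.
move=> d_gt0; pose L t (x : 'I_d * 'I_d) := A t x.2 x.1.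
have := le_trans (fock_form_prod_ge L) (fock_form_le_moment _).
rewrite natrM -mulrA ler_pM2l ?ltr0n ?fact_gt0 // moment_formE prodf_div.
rewrite -natr_prod [_ / _]mulrC ler_pdivrMl; last first.
  by rewrite ltr0n prodn_gt0 // => t; rewrite addn_gt0 d_gt0.
congr (_ <= _ * _).
  by apply: eq_bigr => t _; rewrite /frobenius_sq exchange_big pair_big.
apply: (eq_mean haarE) => U _; rewrite prodrXl -normr_prod; congr (`|_| ^+ 2).
rewrite /word_poly /monomial; under [LHS]eq_bigr do rewrite -big_split /=.
rewrite -(bigA_distr_bigA (fun t x => L t x * U x.1 x.2)).
apply: eq_bigr => t _; under [RHS]eq_bigr do rewrite mxE.
by rewrite pair_big; apply: eq_bigr => -[i j] _; rewrite mulrC.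
Qed.

End Moments.

(** * Integration against the Haar measure *)

Section ComplexContinuity.
Local Open Scope sesquilinear_scope.
Local Open Scope classical_set_scope.
Variables (R : realType) (d : nat).
Local Notation C := R[i].

Lemma continuous_mx (T U : topologicalType) m n (f : T -> 'M[U]_(m, n)) :
  (forall i j, continuous (fun x => f x i j)) -> continuous f.
Proof.
move=> fc x A [P fxP PA].
have : \forall y \near x, forall ij : 'I_m * 'I_n, P ij.1 ij.2 (f y ij.1 ij.2).
  by apply: filter_forall => -[i j]; apply: fc; exact: fxP.
by apply: filterS => y yP; apply: PA => i j; exact: (yP (i, j)).
Qed.

Lemma ReD (x y : C) : complex.Re (x + y) = complex.Re x + complex.Re y.
Proof. exact: (raddfD (@complex.Re R : Rcomplex R -> R)). Qed.

Lemma ReMr (r : R) (x : C) : complex.Re (r%:C%C * x) = r * complex.Re x.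
Proof. by case: x => a b /=; rewrite mul0r subr0. Qed.

Lemma Re_mulNi (x : C) : complex.Re (- 'i%C * x) = complex.Im x.
Proof. by case: x => a b /=; ring. Qed.

Lemma Re_continuous : continuous (fun z : C^o => complex.Re z : R).
Proof.
move=> z A /nbhs_ballP[e e_gt0 eA]; apply/nbhs_ballP.
exists e%:C%C => [|y zy]; first by rewrite /= ltcR.
apply: eA; rewrite /ball /= -ltcR; apply: le_lt_trans zy.
by rewrite -(raddfB (@complex.Re R : Rcomplex R -> R)); exact: normc_ge_Re.
Qed.

Lemma conj_continuous : continuous (fun z : C^o => z^* : C^o).
Proof.
move=> z A /nbhs_ballP[e e_gt0 eA]; apply/nbhs_ballP; exists e => // y zy.
by apply: eA; rewrite /ball /= -rmorphB norm_conjC.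
Qed.

Lemma continuousM_mx (T : topologicalType) (f g : T -> 'M[C^o]_(d, d)) :
  continuous f -> continuous g ->
  continuous (fun x => (f x : 'M[C]_d) *m g x : 'M[C^o]_(d, d)).
Proof.
move=> fc gc; apply: continuous_mx => i j; under eq_fun do rewrite mxE.
apply: (@continuous_big C^o _ _ _ _ (@add_continuous C^o)) => k _ x.
have coord_comp (h : T -> 'M[C^o]_(d, d)) a b :
    continuous h -> {for x, continuous (fun y => h y a b : C^o)}.
  move=> hc.
  apply: (@continuous_comp _ _ _ h (fun M : 'M[C^o]_(d, d) => M a b : C^o)).
    exact: hc.
  exact: coord_continuous.
exact: (continuousM (coord_comp f i k fc) (coord_comp g k j gc)).
Qed.

Lemma mulmx_continuous (V : 'M[C]_d) :
  continuous (fun M : 'M[C^o]_(d, d) => V *m M : 'M[C^o]_(d, d)).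
Proof.
apply: (continuousM_mx (f := fun=> V) (g := id)) => M.
  exact: cst_continuous.
exact: cvg_id.
Qed.

Lemma trmxC_continuous :
  continuous (fun M : 'M[C^o]_(d, d) => (M : 'M[C]_d) ^t* : 'M[C^o]_(d, d)).
Proof.
apply: continuous_mx => i j; under eq_fun do rewrite !mxE.
move=> M; apply: (@continuous_comp _ _ _
  (fun N : 'M[C^o]_(d, d) => N j i : C^o) (fun z : C^o => z^* : C^o)).
  exact: coord_continuous.
exact: conj_continuous.
Qed.

End ComplexContinuity.

Section HaarIntegral.
Local Open Scope sesquilinear_scope.
Local Open Scope classical_set_scope.
Variables (R : realType) (d : nat).
Local Notation C := R[i].
Local Notation unitary := (@unitary_set R d).

Lemma measurable_open (A : set 'M[C^o]_(d, d)) :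
  open A -> measurable (A : set (MB R d)).
Proof. by move=> oA; exact: sub_sigma_algebra. Qed.

Lemma measurable_continuous (f : 'M[C^o]_(d, d) -> R) :
  continuous f -> measurable_fun setT (f : MB R d -> R).
Proof.
move=> /continuousP cf; apply: (measurability _ (RGenOpens.measurableE R)).
move=> _ [_ [a [b ->] <-]]; rewrite setTI; apply: measurable_open.
exact/cf/interval_open.
Qed.

Lemma measurable_mulmx (V : 'M[C]_d) :
  measurable_fun setT (fun M : MB R d => ofC (V *m toC M)).
Proof.
apply: (@measurability _ _ (MB R d) (MB R d) _ _ (@open 'M[C^o]_(d, d))) => //.
move=> _ [A oA <-]; rewrite setTI; apply: measurable_open.
by have /continuousP := @mulmx_continuous R d V; apply.
Qed.

Lemma measurable_unitary_set : measurable unitary.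
Proof.
rewrite -[X in measurable X]setCK; apply: measurableC; apply: measurable_open.
apply: closed_openC.
pose gram (M : 'M[C^o]_(d, d)) : 'M[C^o]_(d, d) := (M : 'M[C]_d) *m M ^t*.
rewrite (_ : unitary = gram @^-1` [set 1%:M]).
  apply: preimage_closed => [M _|].
    apply: (continuousM_mx (f := id)); last exact: trmxC_continuous.
    by move=> N; exact: cvg_id.
  exact: (accessible_closed_set1 (hausdorff_accessible (@norm_hausdorff _ _))).
by apply/seteqP; split=> M /= /unitarymxP.
Qed.

Definition continuous_bounded (F : 'M[C]_d -> C) :=
  continuous (F : 'M[C^o]_(d, d) -> C^o) /\
  exists b : R, forall U, U \is unitarymx -> `|F U| <= b%:C%C.

Lemma continuous_bounded_cst c : continuous_bounded (fun=> c).
Proof.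
split; first by move=> M; exact: cst_continuous.
by exists (complex.Re `|c|) => U _; rewrite RRe_real ?normr_real.
Qed.

Lemma continuous_bounded_coord i j : continuous_bounded (fun U => U i j).
Proof.
split; first exact: coord_continuous.
by exists 1 => U uU; exact: unitarymx_coord_le1.
Qed.

Lemma continuous_boundedD F G : continuous_bounded F -> continuous_bounded G ->
  continuous_bounded (fun U => F U + G U).
Proof.
move=> [cF [a Fa]] [cG [b Gb]].
split; first by move=> M; exact: (cvgD (cF M) (cG M)).
exists (a + b) => U uU; rewrite rmorphD /=.
by rewrite (le_trans (ler_normD _ _)) // lerD ?Fa ?Gb.
Qed.

Lemma continuous_boundedM F G : continuous_bounded F -> continuous_bounded G ->
  continuous_bounded (fun U => F U * G U).
Proof.
move=> [cF [a Fa]] [cG [b Gb]].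
split; first by move=> M; exact: (cvgM (cF M) (cG M)).
by exists (a * b) => U uU; rewrite rmorphM normrM ler_pM ?Fa ?Gb.
Qed.

Lemma continuous_bounded_conj F : continuous_bounded F ->
  continuous_bounded (fun U => (F U)^*).
Proof.
move=> [cF [b Fb]]; split; last by exists b => U uU; rewrite norm_conjC Fb.
by move=> M; apply: continuous_comp (cF M) _; exact: conj_continuous.
Qed.

Lemma continuous_boundedZ c F : continuous_bounded F ->
  continuous_bounded (fun U => c * F U).
Proof. by apply: continuous_boundedM; exact: continuous_bounded_cst. Qed.

Lemma continuous_bounded_mull F V : continuous_bounded F -> V \is unitarymx ->
  continuous_bounded (fun U => F (V *m U)).
Proof.
move=> [cF [b Fb]] uV.
split; last by exists b => U uU; rewrite Fb ?unitarymx_mull.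
move=> M; apply: (@continuous_comp _ _ _
  (fun N : 'M[C^o]_(d, d) => V *m N : 'M[C^o]_(d, d))
  (F : 'M[C^o]_(d, d) -> C^o)).
  exact: mulmx_continuous.
exact: cF.
Qed.

Variable mu : probability (MB R d) R.

Definition haar_Re (F : 'M[C]_d -> C) : R :=
  \int[mu]_(M in unitary) complex.Re (F (toC M)).

(* The imaginary part of [F] is written [Re (- i F)], so that all integrals are
   of real parts. *)
Definition haar_integral (F : 'M[C]_d -> C) : C :=
  complex.Complex (haar_Re F) (haar_Re (fun U => - 'i%C * F U)).

Lemma measurable_Re F : continuous_bounded F ->
  measurable_fun setT (fun M : MB R d => complex.Re (F (toC M))).
Proof.
move=> [cF _]; apply: measurable_continuous => M.
by apply: continuous_comp (cF M) _; exact: Re_continuous.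
Qed.

Lemma integrable_Re F : continuous_bounded F ->
  mu.-integrable unitary (EFin \o (fun M => complex.Re (F (toC M)))).
Proof.
move=> cbF; have [_ [b Fb]] := cbF.
apply: measurable_bounded_integrable.
- exact: measurable_unitary_set.
- by rewrite (le_lt_trans (probability_le1 _ measurable_unitary_set)) ?ltry.
- by apply: measurable_funTS; exact: measurable_Re.
exists b; split=> [|x bx M uM]; first exact: num_real.
apply: le_trans (ltW bx); rewrite -lecR; apply: le_trans (Fb _ uM).
exact: normc_ge_Re.
Qed.

Lemma eq_haar_Re F G : (forall U, U \is unitarymx -> F U = G U) ->
  haar_Re F = haar_Re G.
Proof.
by move=> FG; apply: eq_Rintegral => M; rewrite inE => uM; rewrite FG.
Qed.

Lemma haar_ReD F G : continuous_bounded F -> continuous_bounded G ->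
  haar_Re (fun U => F U + G U) = haar_Re F + haar_Re G.
Proof.
move=> cF cG; have mU := measurable_unitary_set.
rewrite /haar_Re -(RintegralD mU (integrable_Re cF) (integrable_Re cG)).
by apply: eq_Rintegral => M _; exact: ReD.
Qed.

Lemma haar_ReZ r F : continuous_bounded F ->
  haar_Re (fun U => r%:C%C * F U) = r * haar_Re F.
Proof.
move=> cF; rewrite /haar_Re.
rewrite -(RintegralZl _ measurable_unitary_set (integrable_Re cF)).
by apply: eq_Rintegral => M _; exact: ReMr.
Qed.

Lemma haar_integralD F G : continuous_bounded F -> continuous_bounded G ->
  haar_integral (fun U => F U + G U) = haar_integral F + haar_integral G.
Proof.
move=> cF cG; rewrite /haar_integral haar_ReD //.
under [X in complex.Complex _ X]eq_haar_Re do rewrite mulrDr.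
by rewrite haar_ReD //; exact: continuous_boundedZ.
Qed.

Lemma haar_integralZ c F : continuous_bounded F ->
  haar_integral (fun U => c * F U) = c * haar_integral F.
Proof.
move=> cF; have cZ x := continuous_boundedZ x cF.
have haar_ReM x : haar_Re (fun U => x * F U) =
    complex.Re x * haar_Re F - complex.Im x * haar_Re (fun U => - 'i%C * F U).
  rewrite -mulNr -!haar_ReZ // -haar_ReD //; last first.
    by do 2 apply: continuous_boundedZ.
  by apply: eq_haar_Re => U _; rewrite {1}[x]complexE rmorphN /=; ring.
rewrite /haar_integral.
under [X in complex.Complex _ X]eq_haar_Re do rewrite mulrA.
rewrite haar_ReM (haar_ReM (- 'i%C * c)); case: c => a b.
by congr complex.Complex; rewrite /=; ring.
Qed.

Hypothesis haar_mu : haar_prob mu.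

Lemma haar_Re_cst c : haar_Re (fun=> c) = complex.Re c.
Proof.
rewrite /haar_Re (Rintegral_cst _ measurable_unitary_set) /= haar_mu.1.
by rewrite mulr1.
Qed.

Lemma haar_integral_ge0 F : (forall U, U \is unitarymx -> 0 <= F U) ->
  0 <= haar_integral F.
Proof.
move=> F_ge0; rewrite lecE /= (_ : haar_Re (fun U => - 'i%C * F U) = 0).
  rewrite eqxx; apply: Rintegral_ge0 => M uM.
  by have := F_ge0 _ uM; rewrite lecE => /andP[].
rewrite -[RHS](haar_Re_cst 0); apply: eq_Rintegral => M; rewrite inE => uM.
by rewrite Re_mulNi ger0_Im ?F_ge0.
Qed.

Lemma haar_Re_invariant F V : continuous_bounded F -> V \is unitarymx ->
  haar_Re (fun U => F (V *m U)) = haar_Re F.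
Proof.
move=> cF uV; pose phi (M : MB R d) : MB R d := ofC (V *m toC M).
have phi_unitary : phi @^-1` unitary = unitary.
  by apply/funext => M; apply: congr1 (unitarymx_mull (toC M) uV).
have mphi : measurable_fun setT phi := measurable_mulmx V.
pose g (M : MB R d) := complex.Re (F (toC M)).
have mg : measurable_fun setT (EFin \o g).
  by apply/measurable_EFinP; exact: measurable_Re.
have ig : mu.-integrable (phi @^-1` unitary) ((EFin \o g) \o phi).
  by rewrite phi_unitary; exact: integrable_Re (continuous_bounded_mull cF uV).
rewrite /haar_Re /Rintegral; congr fine; rewrite -{1}phi_unitary.
apply: (etrans (esym (integral_pushforward mphi mg ig measurable_unitary_set))).
by apply: eq_measure_integral => A mA _; rewrite /= /pushforward haar_mu.2.
Qed.

Lemma haar_mean_integral : haar_mean continuous_bounded haar_integral.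
Proof.
split.
- exact: continuous_bounded_cst.
- exact: continuous_bounded_coord.
- exact: continuous_boundedD.
- exact: continuous_boundedM.
- exact: continuous_bounded_conj.
- by rewrite /haar_integral !haar_Re_cst mulr1 /= oppr0.
- move=> c F G cF cG; rewrite haar_integralD // ?haar_integralZ //.
  exact: continuous_boundedZ.
- move=> F G FG.
  by congr complex.Complex; apply: eq_haar_Re => U uU; rewrite FG.
- by move=> F _ F_ge0; exact: haar_integral_ge0.
- move=> F V cF uV; congr complex.Complex; first exact: haar_Re_invariant.
  exact: (haar_Re_invariant (continuous_boundedZ (- 'i%C) cF)).
Qed.

End HaarIntegral.

(** * Channels and learning algorithms *)

Section Channels.
Local Open Scope sesquilinear_scope.
Variables (R : realType) (d e : nat).
Local Notation C := R[i].

Definition unvec (psi : 'cV[C]_(d * e)) : 'M[C]_(d, e) :=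
  \matrix_(i, a) psi (mxtens_index (i, a)) 0.

Lemma sum_mxtens_index (V : nmodType) (F : 'I_(d * e) -> V) :
  \sum_x F x = \sum_i \sum_a F (mxtens_index (i, a)).
Proof.
rewrite pair_big (reindex (@mxtens_index d e)) /=; last first.
  exists (@mxtens_unindex d e) => x _; first exact: mxtens_indexK.
  exact: mxtens_unindexK.
by apply: eq_bigr => -[i a].
Qed.

Lemma tens_idE (Phi : 'M[C]_d -> 'M[C]_d) (rho : 'M[C]_(d * e)) i a j b :
  tens_id Phi rho (mxtens_index (i, a)) (mxtens_index (j, b)) =
  Phi (\matrix_(i, j) rho (mxtens_index (i, a)) (mxtens_index (j, b))) i j.
Proof.
pose block a b :=
  Phi (\matrix_(i, j) rho (mxtens_index (i, a)) (mxtens_index (j, b))).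
rewrite /tens_id summxE -/(block a b).
rewrite -[RHS](sum_delta a (fun a' => block a' b i j)).
apply: eq_bigr => a' _; rewrite summxE.
rewrite -(sum_delta b (fun b' => block a' b' i j)) mulr_sumr.
apply: eq_bigr => b' _; rewrite tensmxE mxE -mulnb natrM (eq_sym a) (eq_sym b).
by rewrite mulrA mulrC.
Qed.

Definition trace_preserving (Phi : 'M[C]_d -> 'M[C]_d) :=
  forall X, \tr (Phi X) = \tr X.

Lemma mxtrace_tens_id (Phi : 'M[C]_d -> 'M[C]_d) (rho : 'M[C]_(d * e)) :
  trace_preserving Phi -> \tr (tens_id Phi rho) = \tr rho.
Proof.
move=> trPhi; rewrite /mxtrace !sum_mxtens_index exchange_big.
rewrite [RHS]exchange_big /=; apply: eq_bigr => a _.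
under eq_bigr do rewrite tens_idE.
by rewrite -/(mxtrace _) trPhi; apply: eq_bigr => i _; rewrite mxE.
Qed.

Lemma trace_preserving_unitary_channel (U : 'M[C]_d) :
  U \is unitarymx -> trace_preserving (unitary_channel U).
Proof.
by move=> uU X; rewrite mxtrace_mulC mulmxA (mulmx1C (unitarymxP uU)) mul1mx.
Qed.

Lemma trace_preserving_depolarizing :
  (0 < d)%N -> trace_preserving (@depolarizing R d).
Proof.
move=> d_gt0 X; rewrite mxtrace_scalar -[LHS]mulr_natr mulfVK //.
by rewrite pnatr_eq0 -lt0n.
Qed.

Lemma depolarizing_kraus (X : 'M[C]_d) :
  depolarizing X = d%:R^-1 *: \sum_i \sum_j unitary_channel (delta_mx i j) X.
Proof.
have krausE i j : unitary_channel (delta_mx i j) X = X j j *: delta_mx i i.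
  rewrite /unitary_channel trmxC_delta -(mul_delta_mx (0 : 'I_1) i j).
  rewrite -(mul_delta_mx (0 : 'I_1) j i) !mulmxA.
  rewrite -2!(mulmxA (delta_mx i 0)) -rowE -colE.
  by rewrite [col _ _]mx11_scalar !mxE mul_mx_scalar -scalemxAl mul_delta_mx.
under eq_bigr do (under eq_bigr do rewrite krausE; rewrite -scaler_suml).
by rewrite -scaler_sumr -mx1_sum_delta scalerA scalemx1 mulrC.
Qed.

Lemma tens_id_depolarizing (rho : 'M[C]_(d * e)) :
  tens_id (@depolarizing R d) rho =
  d%:R^-1 *: \sum_i \sum_j tens_id (unitary_channel (delta_mx i j)) rho.
Proof.
apply/matrixP => x y.
case: (mxtens_indexP x) => i a; case: (mxtens_indexP y) => j b.
rewrite tens_idE depolarizing_kraus !mxE !summxE; congr (_ * _).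
apply: eq_bigr => k _; rewrite !summxE; apply: eq_bigr => l _.
by rewrite tens_idE.
Qed.

Lemma densityE D (psi : 'cV[C]_D) x y : density psi x y = psi x 0 * (psi y 0)^*.
Proof. by rewrite mxE big_ord1 !mxE. Qed.

Lemma mxtrace_density D (psi : 'cV[C]_D) :
  \tr (density psi) = \sum_k `|psi k 0| ^+ 2.
Proof. by apply: eq_bigr => k _; rewrite densityE normCK. Qed.

Lemma density_mulmx D D' (S : 'M[C]_(D', D)) (psi : 'cV[C]_D) :
  density (S *m psi) = S *m density psi *m S ^t*.
Proof. by rewrite /density trmxCM !mulmxA. Qed.

Lemma unvec_tensmx1 (K : 'M[C]_d) (psi : 'cV[C]_(d * e)) :
  unvec ((K *t (1%:M : 'M[C]_e)) *m psi) = K *m unvec psi.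
Proof.
apply/matrixP => i a; rewrite !mxE sum_mxtens_index; apply: eq_bigr => j _.
under eq_bigr => b _ do rewrite tensmxE mxE eq_sym mulrAC mulrC.
by rewrite sum_delta mxE.
Qed.

Lemma mxtrace_mul_unvec (phi psi : 'cV[C]_(d * e)) :
  (phi^T *m psi) 0 0 = \tr (unvec psi *m (unvec phi)^T).
Proof.
rewrite mxE sum_mxtens_index; apply: eq_bigr => i _; rewrite mxE.
by apply: eq_bigr => a _; rewrite !mxE mulrC.
Qed.

Lemma tens_id_unitary_channel (K : 'M[C]_d) (psi : 'cV[C]_(d * e)) :
  tens_id (unitary_channel K) (density psi) =
  density ((K *t (1%:M : 'M[C]_e)) *m psi).
Proof.
have unvecE (chi : 'cV[C]_(d * e)) i a :
    chi (mxtens_index (i, a)) 0 = unvec chi i a.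
  by rewrite mxE.
apply/matrixP => x y.
case: (mxtens_indexP x) => i a; case: (mxtens_indexP y) => j b.
rewrite tens_idE densityE !unvecE unvec_tensmx1.
rewrite (_ : \matrix_(i, j) _ = col a (unvec psi) *m (col b (unvec psi)) ^t*).
  rewrite /unitary_channel mulmxA -mulmxA -trmxCM !colE !mulmxA -!colE.
  by rewrite mxE big_ord1 !mxE.
by apply/matrixP => k l; rewrite [LHS]mxE densityE [RHS]mxE big_ord1 !mxE.
Qed.

(* Writing [F = S^* S], the probability is the squared norm of
   [S (U (x) 1) psi], whose entries are linear in [U]. *)
Lemma povm_prob_unitary_channel (F : 'M[C]_(d * e)) (psi : 'cV[C]_(d * e)) :
  psd F ->
  exists A : 'I_(d * e) -> 'M[C]_d,
    forall U, \tr (F *m tens_id (unitary_channel U) (density psi)) =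
      \sum_k `|\tr (U *m A k)| ^+ 2.
Proof.
move=> /psdmx_sqrt[S [SC SS _]].
exists (fun k => unvec psi *m (unvec (row k S)^T)^T) => U.
rewrite tens_id_unitary_channel -SS -mulmxA mxtrace_mulC -{2}SC -density_mulmx.
rewrite mxtrace_density; apply: eq_bigr => k _; congr (`|_| ^+ 2).
rewrite [in RHS]mulmxA -unvec_tensmx1 -mxtrace_mul_unvec trmxK.
by rewrite -row_mul [RHS]mxE.
Qed.

Lemma mxtrace_delta_mul (A : 'M[C]_d) i j : \tr (delta_mx i j *m A) = A j i.
Proof.
rewrite -(mul_delta_mx (0 : 'I_1)) -mulmxA mxtrace_mulC trace_mx11.
by rewrite -rowE -colE !mxE.
Qed.

Lemma povm_prob_depolarizing (F : 'M[C]_(d * e)) (rho : 'M[C]_(d * e))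
    (A : 'I_(d * e) -> 'M[C]_d) :
  (forall U, \tr (F *m tens_id (unitary_channel U) rho) =
    \sum_k `|\tr (U *m A k)| ^+ 2) ->
  \tr (F *m tens_id (@depolarizing R d) rho) =
  (\sum_k frobenius_sq (A k)) / d%:R.
Proof.
move=> probE; rewrite tens_id_depolarizing -scalemxAr mxtraceZ mulrC.
congr (_ / _); rewrite mulmx_sumr raddf_sum.
transitivity (\sum_i \sum_j \sum_k `|A k j i| ^+ 2).
  apply: eq_bigr => i _; rewrite mulmx_sumr raddf_sum; apply: eq_bigr => j _ /=.
  by rewrite probE; apply: eq_bigr => k _; rewrite mxtrace_delta_mul.
rewrite /frobenius_sq exchange_big [RHS]exchange_big.
by apply: eq_bigr => i _; rewrite exchange_big.
Qed.

End Channels.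

Lemma sum_tuple_adaptive_prod (C : comPzSemiRingType) (I : finType) T
    (p : seq I -> I -> C) :
  (forall h, \sum_s p h s = 1) ->
  \sum_(tr : T.-tuple I) \prod_(t < T) p (take t tr) (tnth tr t) = 1.
Proof.
move=> p1.
suff continuation h :
    \sum_(tr : T.-tuple I) \prod_(t < T) p (h ++ take t tr) (tnth tr t) = 1.
  exact: (continuation [::]).
elim: T h => [|T IH] h.
  rewrite (big_pred1 [tuple]) ?big_ord0 // => tr.
  by apply/esym/eqP/val_inj; rewrite (tuple0 tr).
rewrite (reindex (fun q : I * T.-tuple I => [tuple of q.1 :: q.2])) /=;
  last first.
  exists (fun tr : T.+1.-tuple I => (thead tr, [tuple of behead tr]))
    => [[x tr] _|tr _] /=; last by rewrite -tuple_eta.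
  by congr (_, _); apply/val_inj.
rewrite -(pair_bigA _ (fun x (tr : T.-tuple I) =>
  \prod_(t < T.+1)
    p (h ++ take t [tuple of x :: tr]) (tnth [tuple of x :: tr] t))) /=.
rewrite -[RHS](p1 h); apply: eq_bigr => x _.
rewrite -[RHS]mulr1 -[in RHS](IH (rcons h x)) mulr_sumr; apply: eq_bigr => tr _.
rewrite big_ord_recl /= cats0; congr (_ * _).
by apply: eq_bigr => t _; rewrite tnthS /= cat_rcons.
Qed.

Lemma prodr_1sub_ge (R : numDomainType) (I : Type) (r : seq I) (x : I -> R) :
  (forall i, 0 <= x i <= 1) ->
  1 - \sum_(i <- r) x i <= \prod_(i <- r) (1 - x i).
Proof.
move=> x01; elim: r => [|i r IH]; first by rewrite !big_nil subr0.
have /andP[x_ge0 x_le1] := x01 i.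
rewrite !big_cons opprD addrCA addrC mulrBl mul1r lerB // ler_piMr //.
apply: prodr_ile1 => // j _; have /andP[? ?] := x01 j.
by rewrite subr_ge0 gerBl; apply/andP.
Qed.

Lemma prod_ratio_ge (F : numFieldType) (d T : nat) : (0 < d)%N ->
  1 - (T ^ 2)%:R / d%:R <= \prod_(t < T) (d%:R / (d + t)%:R) :> F.
Proof.
move=> d_gt0; have dt_gt0 t : 0 < (d + t)%:R :> F.
  by rewrite ltr0n addn_gt0 d_gt0.
have ratioE (t : 'I_T) : d%:R / (d + t)%:R = 1 - t%:R / (d + t)%:R :> F.
  by rewrite -{1}(addnK t d) natrB ?leq_addl // mulrBl divff // gt_eqF.
rewrite (eq_bigr _ (fun t _ => ratioE t)).
apply: le_trans (prodr_1sub_ge _ _) => [|t]; last first.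
  by rewrite divr_ge0 //= ler_pdivrMr // mul1r ler_nat leq_addl.
rewrite lerD2l lerN2 expnS expn1 natrM -mulrA mulr_natl.
rewrite -[X in _ *+ X]card_ord -sumr_const; apply: ler_sum => t _.
rewrite ler_pM ?invr_ge0 ?ler_nat ?(ltnW (ltn_ord t)) //.
by rewrite lef_pV2 ?posrE ?dt_gt0 ?ltr0n // ler_nat leq_addr.
Qed.

Lemma exp2n_gt0 (n : nat) : (0 < 2 ^ n)%N.
Proof. by rewrite expn_gt0. Qed.

Section Algorithm.
Variables (R : realType) (n n' K T : nat) (A : algo R n n' K).
Local Notation C := R[i].
Local Notation d := (2 ^ n)%N.
Local Notation e := (2 ^ n')%N.
Local Notation depolarizing := (@depolarizing R d).
Hypothesis validA : algo_valid A.

Definition round_prob (Phi : 'M[C]_d -> 'M[C]_d) (h : seq 'I_K)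
    (s : 'I_K) : C :=
  \tr (alg_povm A h s *m tens_id Phi (density (alg_state A h))).

Lemma sum_round_prob Phi h : trace_preserving Phi ->
  \sum_s round_prob Phi h s = 1.
Proof.
move=> trPhi; have [psi_unit [_ povm_sum]] := validA h.
rewrite /round_prob -raddf_sum -mulmx_suml povm_sum mul1mx /=.
by rewrite mxtrace_tens_id // mxtrace_mulC psi_unit mxtrace1.
Qed.

Lemma sum_output_prob Phi : trace_preserving Phi ->
  output_prob T A Phi true + output_prob T A Phi false = 1.
Proof.
move=> trPhi.
rewrite -(sum_tuple_adaptive_prod T (fun h => sum_round_prob h trPhi)).
rewrite [RHS](bigID (fun tr : T.-tuple 'I_K => alg_out A tr)) /=.
by congr (_ + _); apply: eq_bigl => tr; case: (alg_out A tr).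
Qed.

Lemma round_prob_expand h s : exists B : 'I_(d * e) -> 'M[C]_d,
  (forall U,
    round_prob (unitary_channel U) h s = \sum_k `|\tr (U *m B k)| ^+ 2) /\
  round_prob depolarizing h s = (\sum_k frobenius_sq (B k)) / d%:R.
Proof.
have [_ [povm_psd _]] := validA h.
have [B BE] := povm_prob_unitary_channel (alg_state A h) (povm_psd s).
by exists B; split; last exact: povm_prob_depolarizing BE.
Qed.

Lemma round_prob_depolarizing_ge0 h s : 0 <= round_prob depolarizing h s.
Proof.
have [B [_ ->]] := round_prob_expand h s; rewrite divr_ge0 //.
by do 3 apply: sumr_ge0 => ? _; rewrite exprn_ge0.
Qed.

Lemma transcript_prob_depolarizing_ge0 (tr : T.-tuple 'I_K) :
  0 <= transcript_prob A depolarizing tr.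
Proof. by apply: prodr_ge0 => t _; exact: round_prob_depolarizing_ge0. Qed.

Lemma output_prob_depolarizing_ge0 b : 0 <= output_prob T A depolarizing b.
Proof. by apply: sumr_ge0 => tr _; exact: transcript_prob_depolarizing_ge0. Qed.

Variables (test : ('M[C]_d -> C) -> Prop) (E : ('M[C]_d -> C) -> C).
Hypothesis haarE : haar_mean test E.

Lemma test_sqr_norm_mxtrace (B : 'M[C]_d) :
  test (fun U => `|\tr (U *m B)| ^+ 2).
Proof. by apply: (test_sqr_norm haarE); exact: (test_mxtrace haarE). Qed.

Lemma test_round_prob h s : test (fun U => round_prob (unitary_channel U) h s).
Proof.
have [B [BE _]] := round_prob_expand h s; under eq_fun do rewrite BE.
by apply: (test_sum haarE) => k; exact: test_sqr_norm_mxtrace.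
Qed.

Lemma test_transcript_prob (tr : T.-tuple 'I_K) :
  test (fun U => transcript_prob A (unitary_channel U) tr).
Proof. by apply: (test_prod haarE) => t; exact: test_round_prob. Qed.

Lemma test_output_prob b :
  test (fun U => output_prob T A (unitary_channel U) b).
Proof. by apply: (test_sum haarE) => tr; exact: test_transcript_prob. Qed.

Lemma mean_prod_sum_sqr_mxtrace_ge (I : finType) (B : 'I_T -> I -> 'M[C]_d) :
  \prod_t ((\sum_k frobenius_sq (B t k)) / (d + t)%:R) <=
  E (fun U => \prod_t \sum_k `|\tr (U *m B t k)| ^+ 2).
Proof.
under eq_bigr do rewrite mulr_suml; rewrite bigA_distr_bigA /=.
rewrite (eq_mean haarE (G := fun U => \sum_(f : {ffun 'I_T -> I})
  \prod_t `|\tr (U *m B t (f t))| ^+ 2)) => [|U _]; last first.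
  by rewrite bigA_distr_bigA.
rewrite (mean_sum haarE) => [|f]; last first.
  by apply: (test_prod haarE) => t; exact: test_sqr_norm_mxtrace.
apply: ler_sum => f _.
exact: (mean_prod_sqr_mxtrace_ge haarE _ (exp2n_gt0 n)).
Qed.

Lemma mean_transcript_prob_ge (tr : T.-tuple 'I_K) :
  (1 - (T ^ 2)%:R / d%:R) * transcript_prob A depolarizing tr <=
  E (fun U => transcript_prob A (unitary_channel U) tr).
Proof.
have /boolp.choice[B BE] := fun t : 'I_T =>
  round_prob_expand (take t tr) (tnth tr t).
have -> : E (fun U => transcript_prob A (unitary_channel U) tr) =
    E (fun U => \prod_t \sum_k `|\tr (U *m B t k)| ^+ 2).
  by apply: (eq_mean haarE) => U _; apply: eq_bigr => t _; exact: (BE t).1.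
apply: le_trans (mean_prod_sum_sqr_mxtrace_ge B).
rewrite [leRHS](_ : _ =
    (\prod_(t < T) (d%:R / (d + t)%:R)) * transcript_prob A depolarizing tr).
  rewrite ler_wpM2r ?prod_ratio_ge ?exp2n_gt0 //.
  exact: transcript_prob_depolarizing_ge0.
rewrite -big_split; apply: eq_bigr => t _ /=.
rewrite -/(round_prob _ _ _) (BE t).2.
by rewrite [RHS]mulrC mulrA mulfVK // pnatr_eq0 -lt0n exp2n_gt0.
Qed.

Lemma mean_output_prob_ge b :
  (1 - (T ^ 2)%:R / d%:R) * output_prob T A depolarizing b <=
  E (fun U => output_prob T A (unitary_channel U) b).
Proof.
rewrite (mean_sum haarE) => [|tr]; last exact: test_transcript_prob.
by rewrite mulr_sumr ler_sum // => tr _; exact: mean_transcript_prob_ge.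
Qed.

Lemma sum_mean_output_prob :
  E (fun U => output_prob T A (unitary_channel U) true) +
  E (fun U => output_prob T A (unitary_channel U) false) = 1.
Proof.
rewrite -(meanD haarE); [|exact: test_output_prob..].
rewrite -[RHS](mean1 haarE); apply: (eq_mean haarE) => U uU.
by apply: sum_output_prob; exact: trace_preserving_unitary_channel.
Qed.

End Algorithm.

Section SuccessProbability.
Variables (R : realType) (n n' K T : nat) (A : algo R n n' K).
Variable mu : probability (MB R (2 ^ n)) R.
Hypotheses (validA : algo_valid A) (haar_mu : haar_prob mu).

Lemma success_probE :
  success_prob T A mu =
  (2^-1 * (complex.Re (output_prob T A (@depolarizing R (2 ^ n)) false) +
    haar_Re mu (fun U => output_prob T A (unitary_channel U) true)))%:E.
Proof.
rewrite mulrDr EFinD [X in (_ + X)%E]EFinM /success_prob; congr (_ + _ * _)%E.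
rewrite /haar_Re /Rintegral fineK //; apply: integrable_fin_num.
  exact: measurable_unitary_set.
have haarE := haar_mean_integral haar_mu.
exact: integrable_Re (test_output_prob T validA haarE true).
Qed.

Lemma success_prob_le :
  (success_prob T A mu <= (2^-1 * (1 + (T ^ 2)%:R / (2 ^ n)%:R))%:E)%E.
Proof.
rewrite success_probE lee_fin ler_wpM2l ?invr_ge0 //.
have haarE := haar_mean_integral haar_mu.
set dep_false := complex.Re _; set haar_true := haar_Re _ _.
pose haar_false :=
  haar_Re mu (fun U => output_prob T A (unitary_channel U) false).
set loss := _ / _.
have haar_total : haar_true + haar_false = 1.
  have /(congr1 (@complex.Re R)) := sum_mean_output_prob T validA haarE.
  by rewrite ReD.
have haar_false_ge : (1 - loss) * dep_false <= haar_false.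
  have := mean_output_prob_ge T validA haarE false.
  rewrite (_ : 1 - _ = (1 - loss)%:C%C); last first.
    by rewrite /loss rmorphB rmorph1 fmorph_div !rmorph_nat.
  by rewrite lecE ReMr => /andP[].
have dep_le1 : dep_false <= 1.
  have /(congr1 (@complex.Re R)) := sum_output_prob T validA
    (trace_preserving_depolarizing (exp2n_gt0 n)).
  rewrite ReD -/dep_false /= => <-; rewrite lerDr.
  have := output_prob_depolarizing_ge0 T validA true.
  by rewrite lecE => /andP[].
have loss_ge0 : 0 <= loss by rewrite divr_ge0.
have := ler_piMr loss_ge0 dep_le1; lra.
Qed.

End SuccessProbability.

Theorem mainTheorem13 (R : realType) :
  exists c : R, 0 < c /\
  exists N : nat, forall n : nat, (N <= n)%N ->
    forall mu : probability (MB R (2 ^ n)) R, haar_prob mu ->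
    forall (n' K T : nat) (A : algo R n n' K), algo_valid A ->
      ((2 / 3 : R)%:E <= success_prob T A mu)%E ->
      c * (((2 ^ n)%:R : R) `^ (3^-1)) <= T%:R.
Proof.
exists 2^-1; split; first by rewrite invr_gt0.
exists 0%N => n _ mu haar_mu n' K T A validA.
move=> /le_trans/(_ (success_prob_le T validA haar_mu)).
rewrite lee_fin => success_ge.
have d_ge1 : 1 <= (2 ^ n)%:R :> R by rewrite ler1n expn_gt0.
have d_le : (2 ^ n)%:R <= (2 * T%:R) ^+ 2 :> R.
  have : 3^-1 <= (T ^ 2)%:R / (2 ^ n)%:R :> R by lra.
  rewrite ler_pdivlMr ?(lt_le_trans ltr01) // natrX exprMn.
  by have := sqr_ge0 (T%:R : R); lra.
rewrite mulrC ler_pdivrMr // mulrC.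
apply: (@le_trans _ _ ((2 ^ n)%:R `^ 2^-1)).
  by rewrite ler_powR // lef_pV2 ?posrE // ler_nat.
rewrite powR12_sqrt ?(le_trans ler01) // -[leRHS]ger0_norm ?mulr_ge0 //.
by rewrite -sqrtr_sqr ler_wsqrtr.
Qed.
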